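(* Let $\mu$ be a Borel probability measure on $[0,1)$ that is not singular. Then $\{e^{2\pi i nx}\}_{n\in\mathbb{Z}}\subseteq L^2(\mu)$ is an SCFC sequence in $L^2(\mu)$. Conversely, if $\mu$ is a singular Borel probability measure on $[0,1)$ and $B:\operatorname{span}\{e^{2\pi i nx}\}_{n\in\mathbb{Z}}\subseteq L^2(\mu)\to L^2(\mu)$ is a linear map such that $\{Be^{2\pi i nx}\}_{n\in\mathbb{Z}}$ is a Parseval frame in $L^2(\mu)$, then $B$ is not closable.
   Context: Singular means singular with respect to Lebesgue measure on $[0,1)$; ''not singular'' means the absolutely continuous part in the Lebesgue decomposition is nonzero. A family $\{h_n\}_{n\in\mathbb{Z}}$ in a Hilbert space $\mathcal{H}$ is a Parseval frame if $\sum_n|\langle f,h_n\rangle|^2=\|f\|^2$ for all $f\in\mathcal{H}$. A family $\{f_n\}$ in $\mathcal{H}$ is an SCFC sequence if there is a surjective bounded linear operator $B\in B(\mathcal{H})$ such that $\{Bf_n\}$ is a Parseval frame in $\mathcal{H}$. Here $\mathcal{H}=L^2(\mu)$. A linear map defined on a subspace of a Hilbert space is closable if the closure of its graph is the graph of a linear map. *)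

(* Defs.v *)
From HB Require Import structures.
From mathcomp Require Import all_boot all_order all_algebra.
From mathcomp Require Import all_classical all_reals all_analysis.
From mathcomp Require Import measurable_realfun complex.

Set Implicit Arguments.
Unset Strict Implicit.
Unset Printing Implicit Defensive.

Import Order.TTheory GRing.Theory Num.Theory.
Import numFieldNormedType.Exports.
Import Normc.

Local Open Scope classical_set_scope.
Local Open Scope ring_scope.
Local Open Scope complex_scope.
Local Open Scope quotient_scope.

(** MathComp-Analysis only provides real-valued Lp spaces and no measurable
    structure on [R[i]]: measurability of a complex-valued function means
    measurability of its real and imaginary parts. *)
Section square_integrable.
Context d (T : measurableType d) (R : realType).
Variable mu : {measure set T -> \bar R}.

Definition square_integrable (f : T -> R[i]) : Prop :=
  [/\ measurable_fun setT (fun x => complex.Re (f x)),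
      measurable_fun setT (fun x => complex.Im (f x))
    & finite_norm mu 2%:E (fun x => normc (f x))].

Definition sqintegrable : {pred T -> R[i]} := mem [set f | square_integrable f].

Lemma sqintegrableP f : reflect (square_integrable f) (f \in sqintegrable).
Proof. by apply: (iffP idP); rewrite inE. Qed.

Lemma measurable_normc (f : T -> R[i]) :
  measurable_fun setT (fun x => complex.Re (f x)) ->
  measurable_fun setT (fun x => complex.Im (f x)) ->
  measurable_fun setT (fun x => normc (f x)).
Proof.
move=> mRe mIm.
have -> : (fun x => normc (f x)) = Num.sqrt \o
    (fun x => complex.Re (f x) ^+ 2 + complex.Im (f x) ^+ 2).
  by apply/funext => x /=; case: (f x).
apply: measurableT_comp.
  by apply: continuous_measurable_fun => x; exact: sqrt_continuous.
by apply: measurable_funD; apply: measurable_funX.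
Qed.

Lemma Lnorm2E (f : T -> R) :
  ('N[mu]_2%:E[EFin \o f])%E = ((\int[mu]_x (f x ^+ 2)%:E) `^ 2^-1)%E.
Proof.
rewrite unlock /Lnorm; congr (_ `^ _)%E.
by apply: eq_integral => x _ /=; rewrite powR_mulrn ?real_normK ?num_real.
Qed.

Lemma Lnorm2_le (f g : T -> R) :
  measurable_fun setT f -> measurable_fun setT g ->
  (forall x, `|f x| <= g x) ->
  ('N[mu]_2%:E[EFin \o f] <= 'N[mu]_2%:E[EFin \o g])%E.
Proof.
move=> mf mg fg; rewrite !Lnorm2E.
have sq0 h : (0 <= \int[mu]_x (h x ^+ 2 : R)%:E)%E.
  by apply: integral_ge0 => x _; rewrite lee_fin sqr_ge0.
have inv20 : 0 <= 2^-1 :> R by rewrite invr_ge0.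
apply: (gt0_ler_poweR inv20); rewrite ?in_itv/= ?sq0 ?leey//.
apply: ge0_le_integral => //=.
- by move=> x _; rewrite lee_fin sqr_ge0.
- by apply/measurable_EFinP/measurable_funX.
- by apply/measurable_EFinP/measurable_funX.
move=> x _; rewrite lee_fin -(real_normK (num_real (f x))).
by rewrite lerXn2r ?nnegrE// (le_trans (normr_ge0 (f x))).
Qed.

Lemma Lnorm2Z (c : R) (h : T -> R) : 0 <= c -> measurable_fun setT h ->
  ('N[mu]_2%:E[EFin \o (fun x => c * h x)%R] = c%:E * 'N[mu]_2%:E[EFin \o h])%E.
Proof.
move=> c0 mh; rewrite !Lnorm2E.
under eq_integral do rewrite exprMn EFinM.
have mh2 : measurable_fun setT (fun x => (h x ^+ 2)%:E).
  by apply/measurable_EFinP/measurable_funX.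
have h20 x : setT x -> (0 <= (h x ^+ 2)%:E)%E by rewrite lee_fin sqr_ge0.
rewrite ge0_integralZl//; last by rewrite lee_fin sqr_ge0.
rewrite poweRM ?lee_fin ?sqr_ge0//; last exact: integral_ge0.
by rewrite poweR_EFin -powR_mulrn// -powRrM mulfV// powRr1.
Qed.

Lemma normc_ge0 (x : R[i]) : 0 <= normc x.
Proof. by case: x => a b; exact: sqrtr_ge0. Qed.

Lemma Lnorm2_normcD a (f g : T -> R[i]) :
  measurable_fun setT (fun x => complex.Re ((a *: f + g) x)) ->
  measurable_fun setT (fun x => complex.Im ((a *: f + g) x)) ->
  measurable_fun setT (fun x => complex.Re (f x)) ->
  measurable_fun setT (fun x => complex.Im (f x)) ->
  measurable_fun setT (fun x => complex.Re (g x)) ->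
  measurable_fun setT (fun x => complex.Im (g x)) ->
  ('N[mu]_2%:E[EFin \o (fun x => normc ((a *: f + g) x))%R] <=
   (normc a)%:E * 'N[mu]_2%:E[EFin \o (fun x => normc (f x))] +
   'N[mu]_2%:E[EFin \o (fun x => normc (g x))])%E.
Proof.
move=> h1 h2 f1 f2 g1 g2.
have mf := measurable_normc f1 f2; have mg := measurable_normc g1 g2.
have maf : measurable_fun setT (fun x => normc a * normc (f x)).
  exact: measurable_funM.
rewrite -Lnorm2Z ?normc_ge0//.
apply: le_trans (minkowski_EFin mu maf mg (ler1n R 2)).
apply: Lnorm2_le; [exact: measurable_normc|exact: measurable_funD|].
move=> x; rewrite ger0_norm ?normc_ge0//.
rewrite -[leRHS]/(normc a * normc (f x) + normc (g x)) -normcM.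
exact: le_normcD.
Qed.

Lemma sqintegrable_submod_closed : submod_closed sqintegrable.
Proof.
split.
  apply/sqintegrableP; split; try exact: measurable_cst.
  rewrite /finite_norm.
  rewrite (_ : EFin \o _ = cst 0%E) ?Lnorm0 ?eqe ?ltry//.
  by apply/funext => x /=; rewrite expr0n addr0 sqrtr0.
move=> a f g /sqintegrableP[f1 f2 f3] /sqintegrableP[g1 g2 g3].
apply/sqintegrableP.
have h1 : measurable_fun setT (fun x => complex.Re ((a *: f + g) x)).
  rewrite (_ : (fun _ => _) = (fun x => (complex.Re a * complex.Re (f x) -
       complex.Im a * complex.Im (f x)) + complex.Re (g x))); last first.
    apply/funext => x; rewrite !fctE /=.
    by move: (f x) (g x) => [u v] [s t]; try clear h1; case: a.
  apply: measurable_funD => //; apply: measurable_funB;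
    exact: measurable_funM.
have h2 : measurable_fun setT (fun x => complex.Im ((a *: f + g) x)).
  rewrite (_ : (fun _ => _) = (fun x => (complex.Re a * complex.Im (f x) +
       complex.Im a * complex.Re (f x)) + complex.Im (g x))); last first.
    apply/funext => x; rewrite !fctE /=.
    by move: (f x) (g x) => [u v] [s t]; try clear h1; case: a.
  apply: measurable_funD => //; apply: measurable_funD;
    exact: measurable_funM.
split=> //; rewrite /finite_norm.
apply: le_lt_trans (Lnorm2_normcD h1 h2 f1 f2 g1 g2) _.
rewrite lte_add_pinfty//; apply: lte_mul_pinfty => //.
by rewrite lee_fin normc_ge0.
Qed.

End square_integrable.

Section L2_space.
Context d (T : measurableType d) (R : realType).
Variable mu : {measure set T -> \bar R}.

HB.instance Definition _ := GRing.isSubmodClosed.Build R[i] (T -> R[i])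
  (sqintegrable mu) (sqintegrable_submod_closed mu).

Record L2fun := MkL2fun {
  L2fun_val :> T -> R[i];
  L2fun_valP : L2fun_val \in sqintegrable mu }.

HB.instance Definition _ := [isSub for L2fun_val].
HB.instance Definition _ := [Choice of L2fun by <:].
HB.instance Definition _ := [SubChoice_isSubLmodule of L2fun by <:].

Definition aenull : {pred L2fun} := mem [set f : L2fun | f = cst 0 %[ae mu]].

Lemma aenullP (f : L2fun) : reflect (f = cst 0 %[ae mu]) (f \in aenull).
Proof. by apply: (iffP idP); rewrite inE. Qed.

Lemma aenull_submod_closed : submod_closed aenull.
Proof.
split; first by apply/aenullP; exact: ae_eq_refl.
move=> a f g /aenullP f0 /aenullP g0; apply/aenullP.
move: f0 g0; apply: filterS2 => x f0 g0 Dx.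
rewrite -[LHS]/(a * f x + g x); rewrite (f0 Dx) (g0 Dx).
by rewrite mulr0 addr0.
Qed.

HB.instance Definition _ := GRing.isSubmodClosed.Build R[i] L2fun
  aenull aenull_submod_closed.

(** Square-integrable complex-valued functions modulo equality [mu]-a.e. *)
Definition L2 : Type := Quotient.quot aenull.
HB.instance Definition _ := EqQuotient.on L2.
HB.instance Definition _ := GRing.Zmodule.on L2.

Lemma L2_eqP (f g : L2fun) : reflect (f = g %[ae mu]) (\pi_L2 f == \pi_L2 g).
Proof.
rewrite -Quotient.idealrBE.
apply: (iffP (aenullP _)); apply: filterS => x h Dx.
  by apply/eqP; rewrite -subr_eq0; apply/eqP; exact: h.
by rewrite -[LHS]/(f x - g x) (h Dx) subrr.
Qed.

Definition L2scale (a : R[i]) (f : L2) : L2 := \pi_L2 (a *: repr f).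

Lemma pi_L2Z a f : L2scale a (\pi_L2 f) = \pi_L2 (a *: f).
Proof.
apply/eqP; rewrite -Quotient.idealrBE -scalerBr.
by apply: rpredZ; rewrite Quotient.idealrBE reprK.
Qed.

Let pi_L2D (f g : L2fun) : \pi_L2 (f + g) = \pi_L2 f + \pi_L2 g.
Proof. exact: Quotient.pi_add. Qed.

Let L2scaleA a b f : L2scale a (L2scale b f) = L2scale (a * b) f.
Proof. by rewrite -[f]reprK (pi_L2Z b) (pi_L2Z a) (pi_L2Z (a * b)) scalerA. Qed.

Let L2scale1 : left_id 1 L2scale.
Proof. by move=> f; rewrite -[f]reprK pi_L2Z scale1r. Qed.

Let L2scaleDr : right_distributive L2scale +%R.
Proof.
by move=> a f g; rewrite -[f]reprK -[g]reprK -pi_L2D !pi_L2Z scalerDr pi_L2D.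
Qed.

Let L2scaleDl f : {morph L2scale^~ f : a b / a + b}.
Proof. by move=> a b; rewrite -[f]reprK !pi_L2Z scalerDl pi_L2D. Qed.

HB.instance Definition _ := GRing.Zmodule_isLmodule.Build R[i] L2
  L2scaleA L2scale1 L2scaleDr L2scaleDl.


Definition cintegral (h : T -> R[i]) : R[i] :=
  (\int[mu]_x complex.Re (h x)) +i* (\int[mu]_x complex.Im (h x)).

Definition L2dot (f g : L2) : R[i] :=
  cintegral (fun x => repr f x * (repr g x)^*).

Definition L2norm (f : L2) : R :=
  fine ('N[mu]_2%:E[EFin \o (fun x => normc (repr f x))])%E.

Lemma repr_pi_L2 (f : L2fun) : repr (\pi_L2 f) = f %[ae mu].
Proof. by apply/L2_eqP; rewrite reprK. Qed.

Lemma L2fun_measurable_Re (f : L2fun) :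
  measurable_fun setT (fun x => complex.Re (f x)).
Proof. by case/sqintegrableP: (L2fun_valP f). Qed.

Lemma L2fun_measurable_Im (f : L2fun) :
  measurable_fun setT (fun x => complex.Im (f x)).
Proof. by case/sqintegrableP: (L2fun_valP f). Qed.

Lemma L2fun_measurable_normc (f : L2fun) :
  measurable_fun setT (fun x => normc (f x)).
Proof.
apply: measurable_normc; first exact: L2fun_measurable_Re.
exact: L2fun_measurable_Im.
Qed.

Lemma L2fun_finite_norm (f : L2fun) :
  ('N[mu]_2%:E[EFin \o (fun x => normc (f x))] < +oo)%E.
Proof. by case/sqintegrableP: (L2fun_valP f). Qed.

Lemma L2normE (f : L2fun) :
  ((L2norm (\pi_L2 f))%:E = 'N[mu]_2%:E[EFin \o (fun x => normc (f x))])%E.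
Proof.
rewrite /L2norm fineK; last first.
  by rewrite ge0_fin_numE ?Lnorm_ge0// L2fun_finite_norm.
rewrite !Lnorm2E; congr (_ `^ _)%E; apply: ae_eq_integral => //.
- by apply/measurable_EFinP/measurable_funX/L2fun_measurable_normc.
- by apply/measurable_EFinP/measurable_funX/L2fun_measurable_normc.
by apply: filterS (repr_pi_L2 f) => x h Dx; rewrite (h Dx).
Qed.

Lemma ler_L2normD f g :
  (L2norm (f + g))%:C <= (L2norm f)%:C + (L2norm g)%:C.
Proof.
rewrite -rmorphD lecR -lee_fin EFinD.
rewrite -[f]reprK -[g]reprK -pi_L2D !L2normE.
move: (repr f) (repr g) => {}f {}g.
have := @Lnorm2_normcD _ _ _ mu 1 f g.
rewrite scale1r normc1 mul1e; apply.
- exact: (L2fun_measurable_Re (f + g)).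
- exact: (L2fun_measurable_Im (f + g)).
- exact: L2fun_measurable_Re.
- exact: L2fun_measurable_Im.
- exact: L2fun_measurable_Re.
- exact: L2fun_measurable_Im.
Qed.

Lemma L2normZ (a : R[i]) f : (L2norm (a *: f))%:C = `|a| * (L2norm f)%:C.
Proof.
rewrite -[`|a|]/((normc a)%:C) -rmorphM; congr (_%:C).
apply: EFin_inj; rewrite EFinM -[f]reprK.
rewrite -[_ *: _]/(L2scale _ _) pi_L2Z !L2normE.
move: (repr f) => {}f.
rewrite -Lnorm2Z ?normc_ge0//; last exact: L2fun_measurable_normc.
apply: eq_Lnorm => x /=; congr EFin.
by rewrite -normcM.
Qed.

Lemma L2norm0_eq0 f : (L2norm f)%:C = 0 -> f = 0.
Proof.
move=> [fn0]; rewrite -[f]reprK; rewrite -[f]reprK in fn0.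
move: (repr f) fn0 => {}f fn0.
have := L2normE f; rewrite fn0 => /esym /Lnorm_eq0_eq0.
have /measurable_EFinP mf := L2fun_measurable_normc f.
have two0 : (0 < 2%:E :> \bar R)%E by rewrite lte_fin.
move=> /(_ mf two0) h.
rewrite -[RHS](@pi_zeror _ _ _ _ _ (Quotient.quot aenull)).
apply/eqP/L2_eqP.
apply: filterS h => x /[apply] -[] /eq0_normc.
done.
Qed.

HB.instance Definition _ := @Lmodule_isNormed.Build R[i] L2
  (fun f => (L2norm f)%:C) ler_L2normD L2normZ L2norm0_eq0.

Lemma L2dot_norm f : L2dot f f = `|f| ^+ 2.
Proof.
rewrite -[`|f|]/((L2norm f)%:C) -rmorphXn /L2dot /cintegral; congr (_ +i* _).
  rewrite /L2norm Lnorm2E fine_poweR -powR_mulrn ?powR_ge0// -powRrM mulVf//.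
  rewrite powRr1; last first.
    by apply: fine_ge0; apply: integral_ge0 => x _; rewrite lee_fin sqr_ge0.
  apply: eq_Rintegral => x _; case: (repr f x) => a b /=.
  by rewrite sqr_sqrtr ?addr_ge0 ?sqr_ge0// mulrN opprK !expr2.
rewrite /Rintegral integral0_eq// => x _.
by case: (repr f x) => a b /=; rewrite mulrN mulrC addNr.
Qed.

End L2_space.
Arguments L2 {d T R} mu.


(** In this section [dot] is meant to be an inner product inducing the norm
    of [V]; for [L2dot] on [L2 mu] this is [L2dot_norm]. *)
Section operators.
Context (R : realType) (V : normedModType R[i]).

Definition parseval_frame (I : choiceType) (dot : V -> V -> R[i])
    (h : I -> V) : Prop :=
  forall f : V, (\esum_(n in [set: I]) (normc (dot f (h n)) ^+ 2)%:E =
                 (complex.Re `|f| ^+ 2)%:E)%E.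

Definition bounded_operator (B : V -> V) : Prop :=
  exists M : R, forall f : V, `|B f| <= M%:C * `|f|.

Definition SCFC (I : choiceType) (dot : V -> V -> R[i]) (h : I -> V) : Prop :=
  exists B : {linear V -> V},
    [/\ bounded_operator B, forall g : V, exists f : V, B f = g
      & parseval_frame dot (fun n => B (h n))].

Definition lspan (I : Type) (h : I -> V) : set V :=
  [set f | exists (s : seq I) (c : I -> R[i]), f = \sum_(n <- s) c n *: h n].

Definition subspace (D : set V) : Prop :=
  D 0 /\ forall (a : R[i]) f g, D f -> D g -> D (a *: f + g).

(** A linear map with domain the subspace [D] is represented by a total
    function whose values outside [D] are ignored. *)
Definition linear_on (D : set V) (B : V -> V) : Prop :=
  forall (a : R[i]) f g, D f -> D g -> B (a *: f + g) = a *: B f + B g.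

Definition graph_on (D : set V) (B : V -> V) : set (V * V) :=
  [set p | D p.1 /\ p.2 = B p.1].

(** The closure is taken in the product topology of the norm topologies. *)
Definition closable (D : set V) (B : V -> V) : Prop :=
  exists (D' : set V) (B' : V -> V),
    [/\ subspace D', linear_on D' B'
      & closure (graph_on D B) = graph_on D' B'].

End operators.

Section measures.
Context d (T : measurableType d) (R : realType).

Definition mutually_singular (mu nu : set T -> \bar R) : Prop :=
  exists N : set T, [/\ measurable N, mu (~` N) = 0%E & nu N = 0%E].

Definition lebesgue_decomposition (mu lam mua mus : {measure set T -> \bar R})
    : Prop :=
  [/\ mua `<< lam, mutually_singular mus lam
    & forall A, measurable A -> mu A = (mua A + mus A)%E].

Definition has_ac_part (mu lam : {measure set T -> \bar R}) : Prop :=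
  exists mua mus : {measure set T -> \bar R},
    lebesgue_decomposition mu lam mua mus /\ mua setT != 0%E.

(** For finite [mu], by existence and uniqueness of the Lebesgue decomposition,
    the absolutely continuous part is nonzero exactly when [mu] is not
    singular. *)
Lemma has_ac_partP (mu lam : {measure set T -> \bar R}) :
  (mu setT < +oo)%E -> has_ac_part mu lam <-> ~ mutually_singular mu lam.
Proof.
move=> mufin; split.
  move=> [mua [mus [[/null_content_dominatesP ac _ muE] mua0]]].
  move=> [N [mN muN lamN]]; move/eqP: mua0; apply.
  have mCN : measurable (~` N) by exact: measurableC.
  have maN : mua N = 0%E by exact: ac.
  have maC : mua (~` N) = 0%E.
    apply/eqP; rewrite eq_le measure_ge0 andbT -muN muE//.
    by rewrite leeDl.
  have maT : mua setT = (mua N + mua (~` N))%E.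
    by rewrite -measureU ?setUv ?setICr.
  by rewrite maT maN maC adde0.
move=> nsing.
pose S := [set mu N | N in [set N | measurable N /\ lam N = 0%E]].
have S0 : S 0%E by exists set0 => //; split.
have muT A : measurable A -> (mu A <= mu setT)%E.
  by move=> mA; apply: le_measure; rewrite ?inE.
have supfin : ereal_sup S \is a fin_num.
  rewrite ge0_fin_numE; last exact: ereal_sup_ubound.
  apply: le_lt_trans mufin; apply: ge_ereal_sup => _ [N [mN _] <-].
  exact: muT.
have /choice[F FP] : forall k : nat, exists N, [/\ measurable N, lam N = 0%E &
    (ereal_sup S - (k.+1%:R^-1)%:E < mu N)%E].
  move=> k; have k0 : 0 < k.+1%:R^-1 :> R by rewrite invr_gt0.
  have [_ [N [mN lN] <-] SN] := ub_ereal_sup_adherent k0 supfin.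
  by exists N.
pose N := \bigcup_k F k.
have mF k : measurable (F k) by case: (FP k).
have mN : measurable N by exact: bigcup_measurable.
have lN : lam N = 0%E.
  apply/eqP; rewrite eq_le measure_ge0 andbT.
  apply: le_trans (measure_sigma_subadditive lam mF mN (@subset_refl _ N)) _.
  by rewrite eseries0// => k _ _; case: (FP k).
have muN : mu N = ereal_sup S.
  apply/eqP; rewrite eq_le; apply/andP; split.
    by apply: ereal_sup_ubound; exists N.
  apply/lee_addgt0Pr => e e0.
  have [k ke] : exists k : nat, k.+1%:R^-1 < e.
    near \oo%classic => k; exists k.
    by near: k; exact: near_infty_natSinv_lt (PosNum e0).
  have [_ _] := FP k; rewrite lteBlDr// => /ltW /le_trans; apply.
  apply: leeD; last by rewrite lee_fin ltW.
  by apply: le_measure; rewrite ?inE//; exact: bigcup_sup.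
have mCN : measurable (~` N) by exact: measurableC.
exists (mrestr mu mCN), (mrestr mu mN); split; last first.
  rewrite /= /mrestr setTI; apply/eqP => muCN.
  by apply: nsing; exists N.
split.
- apply/null_content_dominatesP => A mA lA; rewrite /= /mrestr.
  have mACN : measurable (A `&` ~` N) by exact: measurableI.
  have : (mu (N `|` (A `&` ~` N)) <= mu N)%E.
    rewrite muN; apply: ereal_sup_ubound; exists (N `|` (A `&` ~` N)) => //.
    split; first exact: measurableU.
    apply/eqP; rewrite eq_le measure_ge0 andbT.
    have lU : (lam (N `|` (A `&` ~` N)) <= lam N + lam (A `&` ~` N))%E.
      exact: measureU2.
    have lAC : (lam (A `&` ~` N) <= lam A)%E.
      by apply: le_measure; rewrite ?inE// => x [].
    have lA' : lam A = 0%E by exact: lA.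
    by apply: le_trans lU _; rewrite lN add0e -lA'.
  have -> : mu (N `|` (A `&` ~` N)) = (mu N + mu (A `&` ~` N))%E.
    by rewrite measureU// setICA setICr setI0.
  rewrite -[leRHS]adde0 leeD2lE; last by rewrite muN.
  by move=> h; apply/eqP; rewrite eq_le h measure_ge0.
- by exists N; split => //; rewrite /= /mrestr setICl measure0.
- move=> A mA; rewrite /= /mrestr.
  rewrite -measureU; [|exact: measurableI|exact: measurableI|].
    by rewrite -setIUr setUC setUv setIT.
  by rewrite setIACA setICl setI0.
Unshelve. all: by end_near.
Qed.

End measures.

(** Lebesgue measure on [0, 1), as a measure on the line. *)
Definition lebesgue01 (R : realType) :
    {measure set (measurableTypeR R) -> \bar R} :=
  mrestr (@lebesgue_measure R) (measurable_itv `[0%R, 1%R[).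

Section exponentials.
Context (R : realType) (mu : probability (measurableTypeR R) R).

Definition expi (n : int) (x : R) : R[i] :=
  cos (2 * pi * n%:~R * x) +i* sin (2 * pi * n%:~R * x).

Lemma expi_sqintegrable (n : int) : expi n \in sqintegrable mu.
Proof.
have cont_lin : continuous (fun x : R => 2 * pi * n%:~R * x).
  by move=> x; exact: mulrl_continuous.
apply/sqintegrableP; split.
- apply: continuous_measurable_fun => x.
  exact: (continuous_comp (cont_lin x) (@continuous_cos R _)).
- apply: continuous_measurable_fun => x.
  exact: (continuous_comp (cont_lin x) (@continuous_sin R _)).
rewrite /finite_norm Lnorm2E.
rewrite (eq_integral (cst 1%E)) ?integral_cst ?mul1e ?probability_setT//.
  apply/poweR_lty/(le_lt_trans (probability_le1 mu measurableT)).
  exact: ltry.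
by move=> x _ /=; rewrite cos2Dsin2 sqrtr1 expr1n.
Qed.

Definition expi_L2 (n : int) : L2 mu :=
  \pi_(L2 mu) (MkL2fun (expi_sqintegrable n)).

End exponentials.

(* Main.v *)
Require Import Defs.
From HB Require Import structures.
From mathcomp Require Import all_boot all_order all_algebra.
From mathcomp Require Import all_classical all_reals all_analysis.
From mathcomp Require Import measurable_realfun complex ring lra.

Set Implicit Arguments.
Unset Strict Implicit.
Unset Printing Implicit Defensive.

Import Order.TTheory GRing.Theory Num.Theory.
Import numFieldNormedType.Exports.
Import Normc.

Local Open Scope classical_set_scope.
Local Open Scope ring_scope.
Local Open Scope complex_scope.
Local Open Scope quotient_scope.

(** Write lam for Lebesgue measure on [0, 1) and e_n for the exponentials.

    Density. For a finite measure nu on [0, 1), consider the bounded functions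
    in the closure of the trigonometric polynomials in L2(nu). They form an
    algebra closed under bounded pointwise limits, hence under the exponential
    function, hence containing the indicators of the positivity sets of its
    members ([trig_bounded_pos]). The sets whose indicators belong to it form a
    sigma-algebra, which contains the level sets of cosine and sine, therefore
    all Borel sets ([trig_set_measurable]). So trigonometric polynomials are
    dense in L2(nu). For nu = lam this gives the Parseval identity of Fourier
    series ([fourier_parseval]).

    Singular case. The Parseval property of the B e_n makes the map B a
    contraction for the norm of L2(lam) on trigonometric polynomials. If mu is singular, density in L2(mu + lam) provides
    trigonometric polynomials that tend to 0 in L2(mu) and to a prescribed e_m
    in L2(lam): L2(mu + lam) is the direct sum of L2(mu) and L2(lam). Their
    images under B tend to B e_m, which is nonzero for some m, so the closure
    of the graph of B is not a graph ([singular_not_closable]).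

    Nonsingular case. If mu is not singular, there is a set A of positive
    Lebesgue measure on which mu and lam dominate each other up to a constant
    ([comparable_set_ex]). Restriction to A is then bounded from L2(mu) to
    L2(lam), and each function of L2(lam) supported in A is in its range. It
    remains to carry the functions supported in A onto L2(mu) by the adjoint
    of an isometry J from L2(mu) to L2(lam) whose values are supported in A.
    Such a J is a composition f |-> c * 1_A * (f o phi), where phi transports
    Lebesgue measure on A, normalized, to mu ([transport_ex]). Its adjoint is
    a Radon-Nikodym derivative ([adjoint_ex]). The operator B, restriction to A
    followed by the adjoint of J, is bounded and onto, and
    sum |<f, B e_n>|^2 = sum |<J f, e_n>|^2 = |J f|^2 = |f|^2
    ([SCFC_of_comparable]). *)

(** * Complex-valued integrals and the inner product of L2 *)

Section complex_integral.
Context d (T : measurableType d) (R : realType).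
Variable mu : {measure set T -> \bar R}.

Lemma sqr_normcE (z : R[i]) : normc z ^+ 2 = complex.Re z ^+ 2 + complex.Im z ^+ 2.
Proof. by case: z => a b /=; rewrite sqr_sqrtr// addr_ge0 ?sqr_ge0. Qed.

Definition cintegrable (h : T -> R[i]) : Prop :=
  mu.-integrable setT (EFin \o (@complex.Re R \o h)) /\
  mu.-integrable setT (EFin \o (@complex.Im R \o h)).

Lemma cReD (a b : R[i]) : complex.Re (a + b) = complex.Re a + complex.Re b.
Proof. by case: a; case: b. Qed.

Lemma cImD (a b : R[i]) : complex.Im (a + b) = complex.Im a + complex.Im b.
Proof. by case: a; case: b. Qed.

Lemma cReM (a b : R[i]) : complex.Re (a * b) =
  complex.Re a * complex.Re b - complex.Im a * complex.Im b.
Proof. by case: a; case: b. Qed.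

Lemma cImM (a b : R[i]) : complex.Im (a * b) =
  complex.Re a * complex.Im b + complex.Im a * complex.Re b.
Proof. by case: a; case: b. Qed.

Lemma complex_ext (a b : R[i]) :
  complex.Re a = complex.Re b -> complex.Im a = complex.Im b -> a = b.
Proof. by case: a; case: b => /= ? ? ? ? -> ->. Qed.

Lemma cintegralZD a (f g : T -> R[i]) : cintegrable f -> cintegrable g ->
  cintegral mu (fun x => a * f x + g x) = a * cintegral mu f + cintegral mu g.
Proof.
move=> [f1 f2] [g1 g2].
have i1 (r : R) : mu.-integrable setT (EFin \o (fun x => r * complex.Re (f x))).
  exact: (integrableZl measurableT r f1).
have i2 (r : R) : mu.-integrable setT (EFin \o (fun x => r * complex.Im (f x))).
  exact: (integrableZl measurableT r f2).
apply: complex_ext; rewrite ?(cReD, cImD, cReM, cImM) /=.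
- under eq_Rintegral do rewrite cReD cReM.
  rewrite RintegralD//; last exact: integrableB (i1 _) (i2 _).
  by rewrite RintegralB// !RintegralZl.
- under eq_Rintegral do rewrite cImD cImM.
  rewrite RintegralD//; last exact: integrableD (i2 _) (i1 _).
  by rewrite RintegralD// !RintegralZl.
Qed.

Lemma cintegral_conj (f : T -> R[i]) : cintegrable f ->
  cintegral mu (fun x => (f x)^*) = (cintegral mu f)^*.
Proof.
move=> [f1 f2]; apply: complex_ext => /=.
- by apply: eq_Rintegral => x _; case: (f x).
- under eq_Rintegral => x _.
    rewrite (_ : complex.Im _ = - 1 * complex.Im (f x)); last first.
      by case: (f x) => a b /=; rewrite mulN1r.
    over.
  by rewrite RintegralZl// mulN1r.
Qed.

Lemma eq_cintegral_ae (f g : T -> R[i]) :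
  measurable_fun setT (@complex.Re R \o f) -> measurable_fun setT (@complex.Im R \o f) ->
  measurable_fun setT (@complex.Re R \o g) -> measurable_fun setT (@complex.Im R \o g) ->
  (f = g %[ae mu]) -> cintegral mu f = cintegral mu g.
Proof.
move=> f1 f2 g1 g2 fg; apply: complex_ext => /=; congr fine;
  apply: ae_eq_integral => //; try exact/measurable_EFinP.
- by apply: filterS fg => x h Dx; rewrite (h Dx).
- by apply: filterS fg => x h Dx; rewrite (h Dx).
Qed.

Lemma integrable_mul2 (f g : T -> R) :
  measurable_fun setT f -> measurable_fun setT g ->
  (\int[mu]_x (f x ^+ 2)%:E < +oo)%E -> (\int[mu]_x (g x ^+ 2)%:E < +oo)%E ->
  mu.-integrable setT (EFin \o (fun x => f x * g x)).
Proof.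
move=> mf mg if2 ig2.
have isq (h : T -> R) : measurable_fun setT h -> (\int[mu]_x (h x ^+ 2)%:E < +oo)%E ->
    mu.-integrable setT (EFin \o (fun x => h x ^+ 2 : R)).
  move=> mh h2; apply/integrableP; split.
    by apply/measurable_EFinP; exact: measurable_funX.
  under eq_integral => x _ do rewrite gee0_abs ?lee_fin ?sqr_ge0//.
  exact: h2.
apply: (le_integrable measurableT _ _ (integrableD measurableT (isq _ mf if2) (isq _ mg ig2))).
  by apply/measurable_EFinP; exact: measurable_funM.
move=> x _ /=; rewrite lee_fin [leRHS]ger0_norm ?addr_ge0 ?sqr_ge0// normrM.
rewrite -(real_normK (num_real (f x))) -(real_normK (num_real (g x))).
have := sqr_ge0 (`|f x| - `|g x|).
have := normr_ge0 (f x); have := normr_ge0 (g x).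
set a := `|f x|; set b := `|g x| => b0 a0; nra.
Qed.

Lemma square_integrableP (f : T -> R[i]) :
  measurable_fun setT (@complex.Re R \o f) -> measurable_fun setT (@complex.Im R \o f) ->
  (\int[mu]_x (normc (f x) ^+ 2)%:E < +oo)%E -> f \in sqintegrable mu.
Proof.
move=> f1 f2 f3; apply/sqintegrableP; split => //; rewrite /finite_norm Lnorm2E.
exact: poweR_lty.
Qed.

Local Notation L2fun := (L2fun mu).

Lemma L2fun_int_lty (f : L2fun) : (\int[mu]_x (normc (f x) ^+ 2)%:E < +oo)%E.
Proof.
have := L2fun_finite_norm f; rewrite Lnorm2E; apply: lty_poweRy.
by rewrite invr_neq0.
Qed.

Lemma L2fun_Re_lty (f : L2fun) : (\int[mu]_x (complex.Re (f x) ^+ 2)%:E < +oo)%E.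
Proof.
apply: le_lt_trans (L2fun_int_lty f); apply: ge0_le_integral => //=.
- by move=> x _; rewrite lee_fin sqr_ge0.
- by apply/measurable_EFinP/measurable_funX; exact: L2fun_measurable_Re.
- by apply/measurable_EFinP/measurable_funX; exact: L2fun_measurable_normc.
by move=> x _; rewrite lee_fin sqr_normcE lerDl sqr_ge0.
Qed.

Lemma L2fun_Im_lty (f : L2fun) : (\int[mu]_x (complex.Im (f x) ^+ 2)%:E < +oo)%E.
Proof.
apply: le_lt_trans (L2fun_int_lty f); apply: ge0_le_integral => //=.
- by move=> x _; rewrite lee_fin sqr_ge0.
- by apply/measurable_EFinP/measurable_funX; exact: L2fun_measurable_Im.
- by apply/measurable_EFinP/measurable_funX; exact: L2fun_measurable_normc.
by move=> x _; rewrite lee_fin sqr_normcE lerDr sqr_ge0.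
Qed.

Lemma cintegrable_L2mul (f g : L2fun) : cintegrable (fun x => f x * (g x)^*).
Proof.
have [f1 f2] := (L2fun_measurable_Re f, L2fun_measurable_Im f).
have [g1 g2] := (L2fun_measurable_Re g, L2fun_measurable_Im g).
have [f3 f4] := (L2fun_Re_lty f, L2fun_Im_lty f).
have [g3 g4] := (L2fun_Re_lty g, L2fun_Im_lty g).
split.
- rewrite (_ : _ \o _ = ((EFin \o (fun x => (complex.Re (f x) * complex.Re (g x))%R)) \+
    (EFin \o (fun x => (complex.Im (f x) * complex.Im (g x))%R)))%E).
    by apply: integrableD => //; exact: integrable_mul2.
  apply/funext => x /=; congr EFin; rewrite cReM.
  by case: (g x) => a b /=; rewrite mulrN opprK.
- rewrite (_ : _ \o _ = ((EFin \o (fun x => (complex.Im (f x) * complex.Re (g x))%R)) \-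
    (EFin \o (fun x => (complex.Re (f x) * complex.Im (g x))%R)))%E).
    by apply: integrableB => //; exact: integrable_mul2.
  apply/funext => x /=; congr EFin; rewrite cImM.
  by case: (g x) => a b /=; rewrite mulrN addrC.
Qed.

Lemma L2dot_pi (f g : L2fun) :
  L2dot (\pi_(L2 mu) f) (\pi_(L2 mu) g) = cintegral mu (fun x => f x * (g x)^*).
Proof.
have m (u v : L2fun) := cintegrable_L2mul u v.
have [i1 i2] := m (repr (\pi_(L2 mu) f)) (repr (\pi_(L2 mu) g)).
have [i3 i4] := m f g.
apply: eq_cintegral_ae; try by apply/measurable_EFinP; exact: measurable_int; eassumption.
- by move/measurable_int : i1 => /measurable_EFinP.
- by move/measurable_int : i2 => /measurable_EFinP.
- by move/measurable_int : i3 => /measurable_EFinP.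
- by move/measurable_int : i4 => /measurable_EFinP.
have := repr_pi_L2 f; have := repr_pi_L2 g.
by apply: filterS2 => x h1 h2 Dx; rewrite (h1 Dx) (h2 Dx).
Qed.

Lemma L2dotZDl a (f g h : L2 mu) : L2dot (a *: f + g) h = a * L2dot f h + L2dot g h.
Proof.
rewrite -[f]reprK -[g]reprK -[h]reprK.
move: (repr f) (repr g) (repr h) => {}f {}g {}h.
have -> : a *: \pi_(L2 mu) f + \pi_(L2 mu) g = \pi_(L2 mu) (a *: f + g).
  rewrite -[_ *: _]/(L2scale _ _) pi_L2Z.
  by rewrite -[RHS]/(\pi_(L2 mu) (a *: f + g)) [RHS]Quotient.pi_add.
rewrite !L2dot_pi -cintegralZD; [|exact: cintegrable_L2mul..].
congr (cintegral mu _); apply/funext => x /=.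
by rewrite mulrA -mulrDl.
Qed.

Lemma L2dotC (f g : L2 mu) : L2dot g f = (L2dot f g)^*.
Proof.
rewrite /L2dot -cintegral_conj; last exact: cintegrable_L2mul.
congr (cintegral mu _); apply/funext => x /=.
by rewrite rmorphM/= conjcK mulrC.
Qed.

End complex_integral.

(** * Parseval frames in an inner product space *)

Section esum_seq.
Context (R : realType) (I : choiceType) (a : I -> R).

Lemma sum_le_esumT (s : seq I) : uniq s ->
  ((\sum_(n <- s) a n)%:E <= \esum_(n in [set: I]) (a n)%:E)%E.
Proof.
move=> us; rewrite -sumEFin fsbig_seq//; apply: ereal_sup_ubound.
by exists [set` s] => //; split => //; exact: finite_seq.
Qed.

Lemma esumT_le (M : \bar R) :
  (forall s : seq I, uniq s -> ((\sum_(n <- s) a n)%:E <= M)%E) ->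
  (\esum_(n in [set: I]) (a n)%:E <= M)%E.
Proof.
move=> h; apply: ge_ereal_sup => _ [A [fA _] <-].
by rewrite fsbig_finite// sumEFin; apply: h; exact: finmap.fset_uniq.
Qed.

End esum_seq.

Section inner_product.
Context (R : realType) (V : normedModType R[i]) (dot : V -> V -> R[i]).
Hypothesis dotZDl : forall a f g h, dot (a *: f + g) h = a * dot f h + dot g h.
Hypothesis dotC : forall f g, dot g f = (dot f g)^*.
Hypothesis dot_norm : forall f, dot f f = `|f| ^+ 2.

Lemma dot0l h : dot 0 h = 0.
Proof.
have := dotZDl (-1) 0 0 h; rewrite scaler0 addr0 mulN1r addNr.
by [].
Qed.

Lemma dotDl f g h : dot (f + g) h = dot f h + dot g h.
Proof. by rewrite -[f in LHS]scale1r dotZDl mul1r. Qed.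

Lemma dotZl a f h : dot (a *: f) h = a * dot f h.
Proof. by rewrite -[_ *: _]addr0 dotZDl dot0l addr0. Qed.

Lemma dotBl f g h : dot (f - g) h = dot f h - dot g h.
Proof. by rewrite -scaleN1r dotDl dotZl mulN1r. Qed.

Lemma dotZDr a f g h : dot h (a *: f + g) = a^*%C * dot h f + dot h g.
Proof. by rewrite dotC dotZDl rmorphD rmorphM/= -!dotC. Qed.

Lemma dotZr a f h : dot h (a *: f) = a^*%C * dot h f.
Proof. by rewrite dotC dotZl rmorphM/= -dotC. Qed.

Lemma dotBr f g h : dot h (f - g) = dot h f - dot h g.
Proof. by rewrite dotC dotBl rmorphB/= -!dotC. Qed.

Lemma dot_suml (I : Type) (s : seq I) (F : I -> V) h :
  dot (\sum_(n <- s) F n) h = \sum_(n <- s) dot (F n) h.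
Proof.
by elim: s => [|n s ih]; rewrite ?big_nil ?dot0l// !big_cons dotDl ih.
Qed.

Lemma dot_sumr (I : Type) (s : seq I) (F : I -> V) h :
  dot h (\sum_(n <- s) F n) = \sum_(n <- s) dot h (F n).
Proof. by rewrite dotC dot_suml rmorph_sum/=; apply: eq_bigr => n _; rewrite -dotC. Qed.

(** The squared norm as a real number: the norm of a normed [R[i]]-module takes
    complex values. *)
Definition nrm2 (f : V) : R := complex.Re `|f| ^+ 2.

Lemma normcr_Re (f : V) : (complex.Re `|f|)%:C = `|f|.
Proof. by rewrite RRe_real// ger0_real. Qed.

Lemma nrm2E f : (nrm2 f)%:C = dot f f.
Proof. by rewrite dot_norm rmorphXn/= normcr_Re. Qed.

Lemma nrm2_ge0 f : 0 <= nrm2 f. Proof. exact: sqr_ge0. Qed.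

Lemma sqr_normcC (z : R[i]) : (normc z ^+ 2)%:C = z * z^*%C.
Proof. by rewrite rmorphXn/= -sqr_normc. Qed.

Lemma dot_nondegenerate v v' : (forall f, dot f v = dot f v') -> v = v'.
Proof.
move=> h; apply/eqP; rewrite -subr_eq0; apply/eqP; apply: normr0_eq0.
apply/eqP; rewrite -sqrf_eq0 -dot_norm dotBr.
by rewrite h subrr.
Qed.

Section orthonormal.
Context (I : choiceType) (e : I -> V).
Hypothesis e_orth : forall m n, dot (e m) (e n) = (m == n)%:R.

(** Pythagoras: the error of an approximation of [f] splits into the error of
    the orthogonal projection and the error made on the coefficients. The
    choices [c n = dot f (e n)] and [f = 0] give Bessel's inequality and the
    norm of a finite combination. *)
Lemma nrm2_sub_proj (s : seq I) c f : uniq s ->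
  nrm2 (f - \sum_(n <- s) c n *: e n) = nrm2 f -
    \sum_(n <- s) normc (dot f (e n)) ^+ 2 +
    \sum_(n <- s) normc (c n - dot f (e n)) ^+ 2.
Proof.
elim: s f => [f _|n s ih f /= /andP[ns us]].
  by rewrite !big_nil !subr0 addr0.
rewrite !big_cons opprD addrA ih//.
have step : nrm2 (f - c n *: e n) = nrm2 f - normc (dot f (e n)) ^+ 2 +
    normc (c n - dot f (e n)) ^+ 2.
  apply: complexI; rewrite rmorphD rmorphB/= !nrm2E !sqr_normcC.
  rewrite rmorphB/= dotBl !dotBr !dotZl !dotZr e_orth eqxx.
  rewrite (dotC f (e n)) /= ?mulr1.
  move: (dot f (e n)) (c n) (dot f f) => u v w. ring.
rewrite step.
have E m : m \in s -> dot (f - c n *: e n) (e m) = dot f (e m).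
  move=> ms; rewrite dotBl dotZl e_orth (_ : n == m = false) ?mulr0 ?subr0//.
  by apply: contraNF ns => /eqP ->.
rewrite (eq_big_seq (fun m => normc (dot f (e m)) ^+ 2)); last first.
  by move=> m ms; rewrite E.
rewrite [X in _ + X](eq_big_seq (fun m => normc (c m - dot f (e m)) ^+ 2)); last first.
  by move=> m ms; rewrite E.
by ring.
Qed.

Lemma bessel (s : seq I) f : uniq s ->
  \sum_(n <- s) normc (dot f (e n)) ^+ 2 <= nrm2 f.
Proof.
move=> us; have := nrm2_sub_proj (fun n => dot f (e n)) f us.
rewrite [X in _ = _ - _ + X]big1 ?addr0; last by move=> n _; rewrite subrr normc0 expr0n.
by move=> h; rewrite -subr_ge0 -h nrm2_ge0.
Qed.

Lemma nrm2_sum (s : seq I) c : uniq s ->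
  nrm2 (\sum_(n <- s) c n *: e n) = \sum_(n <- s) normc (c n) ^+ 2.
Proof.
move=> us; have := nrm2_sub_proj c 0 us.
rewrite sub0r /nrm2 normrN => ->; rewrite normr0 expr0n/= sub0r.
rewrite big1 ?oppr0 ?add0r; last by move=> n _; rewrite dot0l normc0 expr0n.
by apply: eq_bigr => n _; rewrite dot0l subr0.
Qed.

(** Bessel's inequality bounds the sum from above. By Pythagoras no choice of
    coefficients beats the inner products with the [e n], so the finite sums
    miss the squared norm of [f] by at most the error of any approximation. *)
Lemma parseval_of_dense :
  (forall f (eps : R), 0 < eps -> exists (s : seq I) c,
     uniq s /\ nrm2 (f - \sum_(n <- s) c n *: e n) <= eps) ->
  parseval_frame dot e.
Proof.
move=> dense f; apply/eqP; rewrite eq_le; apply/andP; split.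
  by apply: esumT_le => s us; rewrite lee_fin; exact: bessel.
apply/lee_addgt0Pr => eps eps0.
have [s [c [us sc]]] := dense f eps eps0.
apply: (@le_trans _ _ ((\sum_(n <- s) normc (dot f (e n)) ^+ 2)%:E + eps%:E)%E).
  rewrite -EFinD lee_fin; rewrite nrm2_sub_proj// in sc.
  rewrite -/(nrm2 f).
  have : 0 <= \sum_(n <- s) normc (c n - dot f (e n)) ^+ 2.
    by apply: sumr_ge0 => n _; exact: sqr_ge0.
  by move: sc; lra.
by rewrite leeD2r//; exact: (sum_le_esumT (fun n => normc (dot f (e n)) ^+ 2)).
Qed.

End orthonormal.

(** The analysis operator of a Parseval frame is isometric, so its adjoint, the
    synthesis operator, is a contraction. For the vector [g] synthesized from
    [c], the squared norm of [g] is the pairing of [c] with the analysis of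
    [g]; it is at most half the sum of their squared norms, and the second of
    these is at most the squared norm of [g]. *)
Lemma parseval_synthesis (I : choiceType) (h : I -> V) (s : seq I) c :
  parseval_frame dot h -> uniq s ->
  nrm2 (\sum_(n <- s) c n *: h n) <= \sum_(n <- s) normc (c n) ^+ 2.
Proof.
move=> ph us; set g := \sum_(n <- s) _.
have gle : \sum_(n <- s) normc (dot g (h n)) ^+ 2 <= nrm2 g.
  rewrite -lee_fin; apply: le_trans (sum_le_esumT _ us) _.
  by rewrite (ph g).
have : nrm2 g <= \sum_(n <- s) normc (c n) * normc (dot g (h n)).
  have : nrm2 g = complex.Re (\sum_(n <- s) (c n)^* * dot g (h n)).
    rewrite -[LHS]/(complex.Re (nrm2 g)%:C) nrm2E {2}/g dot_sumr.
    by congr complex.Re; apply: eq_bigr => n _; rewrite dotZr.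
  move=> ->; rewrite (_ : complex.Re _ = \sum_(n <- s) complex.Re ((c n)^* * dot g (h n))).
    apply: ler_sum => n _; apply: le_trans (ler_norm _) _.
    rewrite -lecR; apply: le_trans (normc_ge_Re _) _.
    rewrite normrM normcJ -[`|c n|]/((normc (c n))%:C).
    by rewrite -[`|dot _ _|]/((normc (dot g (h n)))%:C) rmorphM.
  elim: (s) => [|n t ih]; first by rewrite !big_nil.
  by rewrite !big_cons -ih; case: (_ * _); case: (\sum_(_ <- _) _).
have : \sum_(n <- s) normc (c n) * normc (dot g (h n)) <=
    2^-1 * (\sum_(n <- s) normc (c n) ^+ 2 +
            \sum_(n <- s) normc (dot g (h n)) ^+ 2).
  rewrite -big_split/= mulr_sumr; apply: ler_sum => n _.
  have := sqr_ge0 (normc (c n) - normc (dot g (h n))).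
  by set u := normc (c n); set v := normc _; lra.
by move: gle; lra.
Qed.

End inner_product.

(** * Reduction to nonnegative functions *)

Section L2_cone.
Context d (T : measurableType d) (R : realType).
Variable mu : {measure set T -> \bar R}.

Lemma pi_L2ZD a (f g : L2fun mu) :
  \pi_(L2 mu) (a *: f + g) = a *: \pi_(L2 mu) f + \pi_(L2 mu) g.
Proof.
rewrite -[a *: \pi_(L2 mu) f]/(L2scale a _) pi_L2Z.
by rewrite -[LHS]/(\pi_(L2 mu) (a *: f + g)) Quotient.pi_add.
Qed.

Lemma L2nrm2E (f : L2fun mu) :
  ((nrm2 (\pi_(L2 mu) f))%:E = \int[mu]_x (normc (f x) ^+ 2)%:E)%E.
Proof.
have E := L2normE f; rewrite Lnorm2E in E.
rewrite /nrm2 -[complex.Re _]/(L2norm (\pi_(L2 mu) f)) -[L2norm _]/(fine (L2norm _)%:E).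
have int0 : (0 <= \int[mu]_x (normc (f x) ^+ 2)%:E)%E.
  by apply: integral_ge0 => x _; rewrite lee_fin sqr_ge0.
rewrite E fine_poweR -powR_mulrn ?powR_ge0// -powRrM mulVf// powRr1 ?fine_ge0//.
by rewrite fineK// ge0_fin_numE// L2fun_int_lty.
Qed.

(** Real and imaginary parts, then positive and negative parts, write every
    element of L2 as a combination of four nonnegative functions. A property
    stable under linear combinations can therefore be tested on those. *)
Lemma L2_nonneg_ind (P : L2 mu -> Prop) :
  (forall a f g, P f -> P g -> P (a *: f + g)) ->
  (forall f : L2fun mu, (forall x, complex.Im (f x) = 0) ->
     (forall x, 0 <= complex.Re (f x)) -> P (\pi_(L2 mu) f)) ->
  forall f, P f.
Proof.
move=> PL P0 f; rewrite -[f]reprK; move: (repr f) => {}f.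
have [m1 m2] := (L2fun_measurable_Re f, L2fun_measurable_Im f).
have mk (h : T -> R) : measurable_fun setT h -> (forall x, 0 <= h x) ->
    (forall x, h x <= normc (f x)) ->
    exists g : L2fun mu, (forall x, g x = (h x)%:C) /\ P (\pi_(L2 mu) g).
  move=> mh h0 hf.
  have hL2 : (fun x => (h x)%:C) \in sqintegrable mu.
    apply: square_integrableP => //; first exact: measurable_cst.
    apply: le_lt_trans (L2fun_int_lty f); apply: ge0_le_integral => //=.
    - under eq_fun do rewrite expr0n addr0 sqrtr_sqr.
      apply/measurable_EFinP; apply: measurable_funX.
      exact: measurableT_comp.
    - by apply/measurable_EFinP/measurable_funX; exact: L2fun_measurable_normc.
    move=> x _; rewrite lee_fin expr0n addr0 sqrtr_sqr ger0_norm//.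
    by rewrite ler_sqr ?nnegrE ?normc_ge0.
  exists (MkL2fun hL2); split => //; exact: P0.
have nRe x : `|complex.Re (f x)| <= normc (f x).
  by rewrite -lecR; exact: normc_ge_Re.
have nIm x : `|complex.Im (f x)| <= normc (f x).
  rewrite -ler_sqr ?nnegrE ?normc_ge0// sqr_normcE real_normK ?num_real//.
  by rewrite lerDr sqr_ge0.
have pos (h : T -> R) : measurable_fun setT h -> (forall x, `|h x| <= normc (f x)) ->
    exists g : L2fun mu, (forall x, g x = (h x)%:C) /\ P (\pi_(L2 mu) g).
  move=> mh hf.
  have [| | |g1 [g1E Pg1]] := mk (fun x => Num.max (h x) 0).
  - by apply: measurable_maxr => //; exact: measurable_cst.
  - by move=> x; rewrite le_max lexx orbT.
  - by move=> x; rewrite ge_max (le_trans (ler_norm _) (hf x)) normc_ge0.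
  have [| | |g2 [g2E Pg2]] := mk (fun x => Num.max (- h x) 0).
  - by apply: measurable_maxr; [exact: measurableT_comp|exact: measurable_cst].
  - by move=> x; rewrite le_max lexx orbT.
  - move=> x; rewrite ge_max normc_ge0 andbT (le_trans _ (hf x))//.
    by rewrite -normrN; exact: ler_norm.
  exists ((-1) *: g2 + g1); split; last by rewrite pi_L2ZD; exact: PL.
  move=> x; rewrite -[LHS]/(-1 * g2 x + g1 x) g1E g2E mulN1r addrC -rmorphB/=.
  by congr (_%:C); rewrite /Num.max; case: ltP => a; case: ltP => b; lra.
have [g1 [g1E Pg1]] := pos _ m1 nRe.
have [g2 [g2E Pg2]] := pos _ m2 nIm.
have -> : f = 'i *: g2 + g1; last by rewrite pi_L2ZD; exact: PL.
apply: val_inj; apply/funext => x.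
rewrite -[RHS]/('i * g2 x + g1 x) g1E g2E addrC; exact: complexE.
Qed.

End L2_cone.

(** * Functions approximated by trigonometric polynomials *)

Section trigonometric_approximation.
Context (R : realType).
Local Notation RT := (measurableTypeR R).
Implicit Types (f g : R -> R[i]) (s : seq (int * R[i])).

Definition cmeasurable f : Prop :=
  measurable_fun (setT : set RT) (@complex.Re R \o f) /\
  measurable_fun (setT : set RT) (@complex.Im R \o f).

Lemma cmeasurableD f g : cmeasurable f -> cmeasurable g ->
  cmeasurable (fun x => f x + g x).
Proof.
move=> [f1 f2] [g1 g2]; split.
- rewrite (_ : _ \o _ = (@complex.Re R \o f) \+ (@complex.Re R \o g)).
    exact: measurable_funD.
  by apply/funext => x /=; rewrite cReD.
- rewrite (_ : _ \o _ = (@complex.Im R \o f) \+ (@complex.Im R \o g)).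
    exact: measurable_funD.
  by apply/funext => x /=; rewrite cImD.
Qed.

Lemma cmeasurableM f g : cmeasurable f -> cmeasurable g ->
  cmeasurable (fun x => f x * g x).
Proof.
move=> [f1 f2] [g1 g2]; split.
- rewrite (_ : _ \o _ = (fun x => complex.Re (f x) * complex.Re (g x)) \-
    (fun x => complex.Im (f x) * complex.Im (g x))).
    by apply: measurable_funB; exact: measurable_funM.
  by apply/funext => x /=; rewrite cReM.
- rewrite (_ : _ \o _ = (fun x => complex.Re (f x) * complex.Im (g x)) \+
    (fun x => complex.Im (f x) * complex.Re (g x))).
    by apply: measurable_funD; exact: measurable_funM.
  by apply/funext => x /=; rewrite cImM.
Qed.

Lemma cmeasurable_cst (c : R[i]) : cmeasurable (fun=> c).
Proof. by split; exact: measurable_cst. Qed.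

Lemma cmeasurableB f g : cmeasurable f -> cmeasurable g ->
  cmeasurable (fun x => f x - g x).
Proof.
move=> mf mg.
rewrite (_ : (fun _ => _) = (fun x => f x + (-1) * g x)).
  by apply: cmeasurableD => //; apply: cmeasurableM => //; exact: cmeasurable_cst.
by apply/funext => x; rewrite mulN1r.
Qed.

Lemma cmeasurable_real (h : R -> R) : measurable_fun (setT : set RT) h ->
  cmeasurable (fun x => (h x)%:C).
Proof. by move=> mh; split => //; exact: measurable_cst. Qed.

Lemma cmeasurable_sqr_normc f : cmeasurable f ->
  measurable_fun (setT : set RT) (fun x => (normc (f x) ^+ 2)%:E).
Proof.
move=> [f1 f2]; apply/measurable_EFinP; apply: measurable_funX.
exact: measurable_normc.
Qed.

Lemma expiD (m n : int) x : expi (m + n) x = expi m x * expi n x :> R[i].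
Proof.
rewrite /expi; apply: complex_ext; rewrite ?(cReM, cImM) /=.
- by rewrite -cosD; congr cos; rewrite rmorphD/=; ring.
- by rewrite [RHS]addrC -sinD; congr sin; rewrite rmorphD/=; ring.
Qed.

Lemma expi0 x : expi 0 x = 1 :> R[i].
Proof. by rewrite /expi mulr0 mul0r cos0 sin0. Qed.

Lemma normc_expi n x : normc (expi n x : R[i]) = 1.
Proof. by rewrite /= cos2Dsin2 sqrtr1. Qed.

Lemma conj_expi n x : (expi n x : R[i])^* = expi (- n) x.
Proof.
rewrite /expi /= rmorphN/= mulrN mulNr cosN sinN.
by [].
Qed.

Lemma cmeasurable_expi n : cmeasurable (expi n).
Proof.
have cont_lin : continuous (fun x : R => 2 * pi * n%:~R * x).
  by move=> x; exact: mulrl_continuous.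
split; apply: continuous_measurable_fun => x.
- exact: (continuous_comp (cont_lin x) (@continuous_cos R _)).
- exact: (continuous_comp (cont_lin x) (@continuous_sin R _)).
Qed.

(** A trigonometric polynomial is given by a list of frequencies with their
    coefficients. Repetitions are allowed, so that addition is concatenation. *)
Definition trigpoly s (x : R) : R[i] := \sum_(p <- s) p.2 * expi p.1 x.

Lemma trigpoly_cons p s x : trigpoly (p :: s) x = p.2 * expi p.1 x + trigpoly s x.
Proof. by rewrite /trigpoly big_cons. Qed.

Lemma trigpoly_cat s t x : trigpoly (s ++ t) x = trigpoly s x + trigpoly t x.
Proof. by rewrite /trigpoly big_cat. Qed.

Lemma trigpoly_nil x : trigpoly [::] x = 0.
Proof. by rewrite /trigpoly big_nil. Qed.

Lemma cmeasurable_trigpoly s : cmeasurable (trigpoly s).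
Proof.
elim: s => [|p s ih].
  rewrite (_ : trigpoly _ = fun=> 0); first exact: cmeasurable_cst.
  by apply/funext => x; exact: trigpoly_nil.
rewrite (_ : trigpoly _ = (fun x => p.2 * expi p.1 x + trigpoly s x)).
  apply: cmeasurableD => //; apply: cmeasurableM; first exact: cmeasurable_cst.
  exact: cmeasurable_expi.
by apply/funext => x; exact: trigpoly_cons.
Qed.

Lemma trigpoly_shift c m s x :
  trigpoly [seq (m + p.1, c * p.2) | p <- s] x = c * (expi m x * trigpoly s x).
Proof.
elim: s => [|p s ih]; first by rewrite /= !trigpoly_nil !mulr0.
rewrite /= !trigpoly_cons ih/= expiD; ring.
Qed.

Section fixed_measure.
Variable nu : {measure set RT -> \bar R}.

Definition int_sqr f : \bar R := (\int[nu]_x (normc (f x) ^+ 2)%:E)%E.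

Lemma int_sqr_ge0 f : (0 <= int_sqr f)%E.
Proof. by apply: integral_ge0 => x _; rewrite lee_fin sqr_ge0. Qed.

Lemma le_int_sqr f g : cmeasurable f -> cmeasurable g ->
  (forall x, normc (f x) <= normc (g x)) -> (int_sqr f <= int_sqr g)%E.
Proof.
move=> mf mg fg; apply: ge0_le_integral => //=.
- by move=> x _; rewrite lee_fin sqr_ge0.
- exact: cmeasurable_sqr_normc.
- exact: cmeasurable_sqr_normc.
- by move=> x _; rewrite lee_fin ler_sqr ?nnegrE ?normc_ge0.
Qed.

Lemma int_sqrZ c f : cmeasurable f ->
  int_sqr (fun x => c * f x) = ((normc c ^+ 2)%:E * int_sqr f)%E.
Proof.
move=> mf; rewrite /int_sqr; under eq_integral do rewrite normcM exprMn EFinM.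
rewrite ge0_integralZl//; first exact: cmeasurable_sqr_normc.
- by move=> x _; rewrite lee_fin sqr_ge0.
- by rewrite lee_fin sqr_ge0.
Qed.

Lemma sqr_normcD_le (a b : R[i]) :
  normc (a + b) ^+ 2 <= 2 * normc a ^+ 2 + 2 * normc b ^+ 2.
Proof.
have := le_normcD a b; have := normc_ge0 (a + b).
move: (normc _) (normc a) (normc b) => u v w u0 uvw.
have := sqr_ge0 (v - w); have : u ^+ 2 <= (v + w) ^+ 2.
  by rewrite ler_sqr ?nnegrE// (le_trans u0).
lra.
Qed.

Lemma int_sqrD f g : cmeasurable f -> cmeasurable g ->
  (int_sqr (fun x => f x + g x)%R <= 2%:E * int_sqr f + 2%:E * int_sqr g)%E.
Proof.
move=> mf mg; have [m1 m2] := (cmeasurable_sqr_normc mf, cmeasurable_sqr_normc mg).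
rewrite -!ge0_integralZl//; try by move=> x _; rewrite lee_fin sqr_ge0.
rewrite -ge0_integralD//=; first last.
- exact: measurable_funeM.
- by move=> x _; rewrite -EFinM lee_fin mulr_ge0 ?sqr_ge0.
- exact: measurable_funeM.
- by move=> x _; rewrite -EFinM lee_fin mulr_ge0 ?sqr_ge0.
apply: ge0_le_integral => //=.
- by move=> x _; rewrite lee_fin sqr_ge0.
- by apply: cmeasurable_sqr_normc; exact: cmeasurableD.
- by apply: emeasurable_funD; exact: measurable_funeM.
- by move=> x _; rewrite -!EFinM -EFinD lee_fin; exact: sqr_normcD_le.
Qed.

(** Membership in the closure of the trigonometric polynomials in L2(nu), stated
    on functions rather than classes so that pointwise limits make sense. *)
Definition trig_approx f : Prop := cmeasurable f /\
  forall eps : R, 0 < eps -> exists s,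
    (int_sqr (fun x => f x - trigpoly s x)%R <= eps%:E)%E.

Lemma trig_approx_close f : cmeasurable f ->
  (forall eps : R, 0 < eps -> exists2 g, trig_approx g &
    (int_sqr (fun x => f x - g x)%R <= eps%:E)%E) -> trig_approx f.
Proof.
move=> mf h; split => // e e0.
(* Each of the two errors is doubled when they are added. *)
have e4 : 0 < e / 4 by rewrite divr_gt0.
have [g [mg gK] fg] := h _ e4; have [s sg] := gK _ e4; exists s.
have ms := cmeasurable_trigpoly s.
rewrite [X in int_sqr X](_ : _ = fun x => (f x - g x) + (g x - trigpoly s x)); last first.
  by apply/funext => x; rewrite addrA subrK.
apply: le_trans (int_sqrD _ _) _; try exact: cmeasurableB.
have -> : e%:E = (2%:E * (e / 4)%:E + 2%:E * (e / 4)%:E)%E.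
  by rewrite -!EFinM -EFinD; congr EFin; field.
by apply: leeD; apply: lee_wpmul2l.
Qed.

Lemma trig_approx_trigpoly s : trig_approx (trigpoly s).
Proof.
split; first exact: cmeasurable_trigpoly.
move=> e e0; exists s; rewrite /int_sqr.
under eq_integral do rewrite subrr normc0 expr0n.
by rewrite integral0 lee_fin ltW.
Qed.

Lemma trig_approxZ c m f : trig_approx f -> trig_approx (fun x => c * (expi m x * f x)).
Proof.
move=> [mf fK].
have mcf : cmeasurable (fun x => c * (expi m x * f x)).
  apply: cmeasurableM; first exact: cmeasurable_cst.
  by apply: cmeasurableM => //; exact: cmeasurable_expi.
split=> // e e0.
(* Adding 1 covers the case c = 0. *)
have e1 : 0 < e / (normc c ^+ 2 + 1) by rewrite divr_gt0// ltr_wpDl ?sqr_ge0.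
have [s fs] := fK _ e1; exists [seq (m + p.1, c * p.2) | p <- s].
have msub : cmeasurable (fun x => f x - trigpoly s x).
  by apply: cmeasurableB => //; exact: cmeasurable_trigpoly.
rewrite [X in int_sqr X](_ : _ = fun x => c * (expi m x * (f x - trigpoly s x))); last first.
  by apply/funext => x; rewrite trigpoly_shift; ring.
rewrite int_sqrZ; last by apply: cmeasurableM => //; exact: cmeasurable_expi.
rewrite /int_sqr; under eq_integral do rewrite normcM normc_expi mul1r.
rewrite -/(int_sqr _).
apply: le_trans (lee_wpmul2l _ fs) _; first by rewrite lee_fin sqr_ge0.
rewrite -EFinM lee_fin mulrCA ger_pMr// ler_pdivrMr ?mul1r ?lerDl//.
by rewrite ltr_wpDl ?sqr_ge0.
Qed.

Lemma trig_approxD f g : trig_approx f -> trig_approx g ->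
  trig_approx (fun x => f x + g x).
Proof.
move=> [mf fK] [mg gK]; split; first exact: cmeasurableD.
move=> e e0; have e4 : 0 < e / 4 by rewrite divr_gt0.
have [s fs] := fK _ e4; have [t gt] := gK _ e4; exists (s ++ t).
have [ms mt] := (cmeasurable_trigpoly s, cmeasurable_trigpoly t).
rewrite [X in int_sqr X](_ : _ =
    fun x => (f x - trigpoly s x) + (g x - trigpoly t x)); last first.
  by apply/funext => x; rewrite trigpoly_cat; ring.
apply: le_trans (int_sqrD _ _) _; try exact: cmeasurableB.
have -> : e%:E = (2%:E * (e / 4)%:E + 2%:E * (e / 4)%:E)%E.
  by rewrite -!EFinM -EFinD; congr EFin; field.
by apply: leeD; apply: lee_wpmul2l.
Qed.

Lemma trig_approx_cst c : trig_approx (fun=> c).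
Proof.
rewrite (_ : (fun=> c) = trigpoly [:: (0, c)]); first exact: trig_approx_trigpoly.
by apply/funext => x; rewrite trigpoly_cons trigpoly_nil expi0 mulr1 addr0.
Qed.

Lemma trig_approx_trigpolyM s f : trig_approx f -> trig_approx (fun x => trigpoly s x * f x).
Proof.
move=> fK; elim: s => [|p s ih].
  rewrite (_ : (fun _ => _) = fun=> 0); first exact: trig_approx_cst.
  by apply/funext => x; rewrite trigpoly_nil mul0r.
rewrite (_ : (fun _ => _) = fun x => p.2 * (expi p.1 x * f x) + trigpoly s x * f x).
  by apply: trig_approxD => //; exact: trig_approxZ.
by apply/funext => x; rewrite trigpoly_cons; ring.
Qed.

(** Multiplication by the bounded function [f] is continuous on L2(nu), so it is
    enough to approximate [f * p] for a trigonometric polynomial [p]; and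
    multiplication by [p] preserves the closure. *)
Lemma trig_approxM f g (M : R) : trig_approx f -> trig_approx g ->
  (forall x, normc (f x) <= M) -> trig_approx (fun x => f x * g x).
Proof.
move=> fK gK fM; have [mf _] := fK; have [mg gK'] := gK.
have M0 : 0 <= M by apply: le_trans (fM 0); exact: normc_ge0.
apply: trig_approx_close; first exact: cmeasurableM.
move=> e e0.
have e1 : 0 < e / (M ^+ 2 + 1) by rewrite divr_gt0// ltr_wpDl ?sqr_ge0.
have [s gs] := gK' _ e1; exists (fun x => trigpoly s x * f x).
  exact: trig_approx_trigpolyM.
have ms := cmeasurable_trigpoly s.
apply: (@le_trans _ _ (int_sqr (fun x => M%:C * (g x - trigpoly s x)))).
  apply: le_int_sqr.
  - by apply: cmeasurableB; exact: cmeasurableM.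
  - by apply: cmeasurableM; [exact: cmeasurable_cst|exact: cmeasurableB].
  - move=> x; rewrite [trigpoly s x * _]mulrC -mulrBr !normcM.
    rewrite ler_wpM2r ?normc_ge0// (le_trans (fM x))//=.
    by rewrite expr0n addr0 sqrtr_sqr ler_norm.
rewrite int_sqrZ; last exact: cmeasurableB.
rewrite /= expr0n addr0 sqrtr_sqr ger0_norm//.
apply: le_trans (lee_wpmul2l _ gs) _; first by rewrite lee_fin sqr_ge0.
rewrite -EFinM lee_fin mulrCA ger_pMr// ler_pdivrMr ?mul1r ?lerDl//.
by rewrite ltr_wpDl ?sqr_ge0.
Qed.

(** Dominated convergence. *)
Lemma trig_approx_lim (f_ : nat -> R -> R[i]) f (h : R -> R) :
  (forall n, trig_approx (f_ n)) -> cmeasurable f ->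
  (forall x, normc (f x - f_ n x) @[n --> \oo] --> (0 : R)) ->
  nu.-integrable setT (EFin \o h) ->
  (forall n x, normc (f x - f_ n x) ^+ 2 <= h x) -> trig_approx f.
Proof.
move=> fK mf ff ih fh; apply: trig_approx_close => // e e0.
have mfn n : cmeasurable (fun x => f x - f_ n x).
  by apply: cmeasurableB => //; have [] := fK n.
have lim0 : int_sqr (fun x => f x - f_ n x) @[n --> \oo] --> 0%E.
  rewrite -(integral0 nu setT).
  have [] := @dominated_convergence _ _ _ nu setT measurableT
    (fun n x => (normc (f x - f_ n x) ^+ 2)%:E) (fun=> 0%E) (EFin \o h)
    (fun n => cmeasurable_sqr_normc (mfn n)) _ _ ih _ => //.
  - apply: aeW => x _; apply: cvg_EFin; first by near=> n.
    have := cvgM (ff x) (ff x); rewrite mulr0 => h0; exact: h0.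
  - by apply: aeW => x n _; rewrite gee0_abs ?lee_fin ?sqr_ge0//; exact: fh.
have /fine_cvgP[fin] := lim0; move=> /cvgr_lt/(_ _ e0) small.
have [N _ hN] : \forall n \near \oo, (int_sqr (fun x => f x - f_ n x)%R <= e%:E)%E.
  by near=> n; rewrite -[leLHS]fineK ?lee_fin; [apply: ltW|]; near: n.
by exists (f_ N) => //; exact: hN (leqnn N).
Unshelve. all: by end_near.
Qed.

End fixed_measure.
End trigonometric_approximation.

Section bounded_trigonometric_closure.
Context (R : realType).
Local Notation RT := (measurableTypeR R).
Variable nu : {measure set RT -> \bar R}.
Hypothesis nufin : (nu setT < +oo)%E.
Implicit Types f g : R -> R.

Lemma normc_real (a : R) : normc a%:C = `|a|.
Proof. by rewrite /= expr0n addr0 sqrtr_sqr. Qed.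

(** The bounded real functions in the closure: they form an algebra by
    [trig_approxM], and this algebra is closed under bounded pointwise limits. *)
Definition trig_bounded f : Prop :=
  trig_approx nu (fun x => (f x)%:C) /\ exists M, forall x, `|f x| <= M.

Lemma trig_boundedD f g : trig_bounded f -> trig_bounded g -> trig_bounded (f \+ g).
Proof.
move=> [fK [M fM]] [gK [N gN]]; split.
  rewrite (_ : (fun _ => _) = fun x => (f x)%:C + (g x)%:C).
    exact: trig_approxD.
  by apply/funext => x; rewrite -rmorphD.
by exists (M + N) => x; rewrite (le_trans (ler_normD _ _))// lerD.
Qed.

Lemma trig_boundedM f g : trig_bounded f -> trig_bounded g -> trig_bounded (f \* g).
Proof.
move=> [fK [M fM]] [gK [N gN]]; split.
  rewrite (_ : (fun _ => _) = fun x => (f x)%:C * (g x)%:C).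
    by apply: (trig_approxM fK gK (M := M)) => x; rewrite normc_real.
  by apply/funext => x; rewrite -rmorphM.
by exists (M * N) => x; rewrite normrM ler_pM.
Qed.

Lemma trig_bounded_cst c : trig_bounded (fun=> c).
Proof. by split; [exact: trig_approx_cst|exists `|c|]. Qed.

Lemma trig_boundedZ c f : trig_bounded f -> trig_bounded (fun x => c * f x).
Proof. by move=> fK; exact: (trig_boundedM (trig_bounded_cst c)). Qed.

Lemma trig_boundedB f g : trig_bounded f -> trig_bounded g -> trig_bounded (f \- g).
Proof.
move=> fK gK; rewrite (_ : f \- g = f \+ (fun x => -1 * g x)).
  by apply: trig_boundedD => //; exact: trig_boundedZ.
by apply/funext => x /=; rewrite mulN1r.
Qed.

Lemma trig_boundedX f n : trig_bounded f -> trig_bounded (fun x => f x ^+ n).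
Proof.
move=> fK; elim: n => [|n ih].
  rewrite (_ : (fun _ => _) = fun=> 1); first exact: trig_bounded_cst.
  by apply/funext => x; rewrite expr0.
rewrite (_ : (fun _ => _) = f \* (fun x => f x ^+ n)); first exact: trig_boundedM.
by apply/funext => x; rewrite exprS.
Qed.

Lemma trig_bounded_measurable f : trig_bounded f -> measurable_fun (setT : set RT) f.
Proof. by case=> [[[]]]. Qed.

Lemma trig_bounded_sum (I : Type) (s : seq I) (f_ : I -> R -> R) :
  (forall n, trig_bounded (f_ n)) -> trig_bounded (fun x => \sum_(n <- s) f_ n x).
Proof.
move=> fK; elim: s => [|n s ih].
  rewrite (_ : (fun _ => _) = fun=> 0); first exact: trig_bounded_cst.
  by apply/funext => x; rewrite big_nil.
rewrite (_ : (fun _ => _) = f_ n \+ (fun x => \sum_(n <- s) f_ n x)).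
  exact: trig_boundedD.
by apply/funext => x; rewrite big_cons.
Qed.

Lemma trig_bounded_lim (f_ : nat -> R -> R) f M :
  (forall n, trig_bounded (f_ n)) -> (forall n x, `|f_ n x| <= M) ->
  (forall x, f_ n x @[n --> \oo] --> f x) -> trig_bounded f.
Proof.
move=> fK fM ff.
have fM' x : `|f x| <= M.
  have /cvg_lim <- // : `|f_ n x| @[n --> \oo] --> `|f x| by apply: cvg_norm; exact: ff.
  apply: limr_le; first by apply/cvg_ex; exists `|f x|; apply: cvg_norm; exact: ff.
  by apply: nearW => n.
have M0 : 0 <= M by apply: le_trans (fM' 0).
split; last by exists M.
have mf : measurable_fun (setT : set RT) f.
  apply: (measurable_fun_cvg (h := f_)) => [n|x _]; last exact: ff.
  exact: trig_bounded_measurable.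
apply: (@trig_approx_lim _ nu (fun n x => (f_ n x)%:C) _ (fun=> (2 * M) ^+ 2)).
- by move=> n; have [] := fK n.
- exact: cmeasurable_real.
- move=> x; under eq_fun do rewrite -rmorphB normc_real.
  rewrite -(normr0 R) -[X in `|X|](subrr (f x)); apply: cvg_norm.
  by apply: cvgB (ff x); exact: cvg_cst.
- apply/integrableP; split; first exact: measurable_cst.
  by rewrite integral_cst// lte_mul_pinfty.
- move=> n x; rewrite -rmorphB normc_real ler_sqr ?nnegrE ?mulr_ge0//.
  by rewrite (le_trans (ler_normB _ _))// mulr_natl mulr2n lerD.
Qed.

(** The Taylor sums of the exponential at the values of [f] are bounded by
    [expR M] if [M] bounds [f]. *)
Lemma trig_bounded_expR f : trig_bounded f -> trig_bounded (fun x => expR (f x)).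
Proof.
move=> fK; have [_ [M fM]] := fK.
apply: (@trig_bounded_lim (fun n x => series (exp_coeff (f x)) n) _ (expR M)).
- move=> n; apply: trig_bounded_sum => k.
  rewrite (_ : (fun _ => _) = fun x => k`!%:R^-1 * f x ^+ k).
    by apply: trig_boundedZ; exact: trig_boundedX.
  by apply/funext => x; rewrite exp_coeffE.
- move=> n x; apply: (@le_trans _ _ (series (exp_coeff M) n)).
    rewrite /series/=; apply: le_trans (ler_norm_sum _ _ _) _.
    apply: ler_sum => k _; rewrite !exp_coeffE normrM normrX ger0_norm ?invr_ge0//.
    by rewrite ler_wpM2l ?invr_ge0// lerXn2r ?nnegrE// (le_trans _ (fM x)).
  apply: nondecreasing_cvgn_le; last exact: is_cvg_series_exp_coeff.
  apply: nondecreasing_series => k _ _; apply: exp_coeff_ge0.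
  exact: le_trans (fM x).
- by move=> x; exact: is_cvg_series_exp_coeff.
Qed.

(** An approximation of the Heaviside function by functions with values in the
    unit interval, built from exponentials only. The outer factor [n] settles
    the case [t = 0]: there the inner exponential stays equal to 1, and the
    limit is that of [expR (- n)]. *)
Lemma cvg_double_exp (t : R) :
  expR (- n%:R * expR (- n%:R * t)) @[n --> \oo] --> ((0 < t)%R%:R : R).
Proof.
have [t0|t0] := ltP 0 t; rewrite ?mulr1n ?mulr0n.
- have : 2 / t ^+ 2 * n.+1%:R^-1 @[n --> \oo] --> (0 : R).
    rewrite -(mulr0 (2 / t ^+ 2)); apply: cvgM; first exact: cvg_cst.
    exact: cvg_harmonic.
  move=> h0.
  have : n%:R * expR (- n%:R * t) @[n --> \oo] --> (0 : R).
    rewrite -(cvg_shiftS (fun n => n%:R * expR (- n%:R * t))).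
    apply: (squeeze_cvgr _ (cvg_cst 0) h0); apply: nearW => n.
    rewrite mulr_ge0 ?expR_ge0//=.
    have n0 : 0 < n.+1%:R :> R by [].
    (* The quadratic term of the exponential series beats the factor n. *)
    have := @expR_ge1Dxn R (n.+1%:R * t) 1 (mulr_ge0 (ltW n0) (ltW t0)).
    rewrite mulNr expRN => h.
    have e0 : 0 < (n.+1%:R * t) ^+ 2 / 2 by rewrite divr_gt0// exprn_gt0// mulr_gt0.
    have h' : (n.+1%:R * t) ^+ 2 / 2 <= expR (n.+1%:R * t).
      by apply: le_trans h; rewrite lerDr.
    rewrite -lef_pV2 ?posrE ?expR_gt0// in h'.
    apply: le_trans (ler_wpM2l (ltW n0) h') _.
    rewrite le_eqVlt; apply/orP; left; apply/eqP.
    move: n0 t0; clear; move: n.+1%:R => N N0 t0; field.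
    by rewrite !gt_eqF.
  move=> /(cvgB (cvg_cst (1 : R))); rewrite subr0 => h1.
  apply: (squeeze_cvgr _ h1 (cvg_cst (1 : R))); apply: nearW => n.
  have y0 : 0 <= n%:R * expR (- n%:R * t) by rewrite mulr_ge0 ?expR_ge0.
  rewrite (mulNr n%:R (expR _)) expR_le1 oppr_le0 y0 andbT.
  exact: expR_ge1Dx.
- apply: (squeeze_cvgr _ (cvg_cst 0) (@cvgn_expR R)); apply: nearW => n.
  rewrite expR_ge0/= ler_expR mulNr lerN2.
  rewrite -[leLHS]mulr1 ler_wpM2l// -expR0 ler_expR mulNr oppr_ge0.
  by rewrite mulr_ge0_le0.
Qed.

(** Since the algebra is closed under exponentials and bounded limits, it
    contains the indicators of the sets where its members are positive. *)
Lemma trig_bounded_pos f : trig_bounded f -> trig_bounded (fun x => (0 < f x)%R%:R).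
Proof.
move=> fK.
apply: (@trig_bounded_lim (fun n x => expR (- n%:R * expR (- n%:R * f x))) _ 1).
- move=> n; apply: trig_bounded_expR; apply: trig_boundedZ.
  by apply: trig_bounded_expR; exact: trig_boundedZ.
- move=> n x; have y0 : 0 <= n%:R * expR (- n%:R * f x) by rewrite mulr_ge0 ?expR_ge0.
  have e1 : expR (- n%:R * expR (- n%:R * f x)) <= 1 by rewrite expR_le1 mulNr oppr_le0.
  by rewrite ger0_norm// expR_ge0.
- by move=> x; exact: cvg_double_exp.
Qed.

(** By the algebra structure and bounded limits these sets form a
    sigma-algebra. *)
Definition trig_set (A : set RT) : Prop := trig_bounded (\1_A : R -> R).

Lemma trig_setC A : trig_set A -> trig_set (~` A).
Proof.
move=> AK; rewrite /trig_set (_ : \1_(~` A) = (fun=> 1) \- \1_A :> (R -> R)).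
  by apply: trig_boundedB => //; exact: trig_bounded_cst.
by apply/funext => x /=; rewrite !indicE in_setC; case: (x \in A); rewrite ?subrr ?subr0.
Qed.

Lemma trig_setI A B : trig_set A -> trig_set B -> trig_set (A `&` B).
Proof.
move=> AK BK; rewrite /trig_set (_ : \1_(A `&` B) = \1_A \* \1_B :> (R -> R)).
  exact: trig_boundedM.
by apply/funext => x; rewrite indicI.
Qed.

Lemma trig_setU A B : trig_set A -> trig_set B -> trig_set (A `|` B).
Proof.
move=> AK BK; rewrite -[_ `|` _]setCK setCU.
by apply: trig_setC; apply: trig_setI; exact: trig_setC.
Qed.

Lemma trig_set_bigcup (A : nat -> set RT) : (forall n, trig_set (A n)) ->
  trig_set (\bigcup_n A n).
Proof.
move=> AK.
(* Finite unions belong to the class, and their indicators tend to that of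
   the whole union. *)
pose U n := \big[setU/set0]_(i < n) A i.
have UK n : trig_set (U n).
  rewrite /U; elim: n => [|n ih]; last by rewrite big_ord_recr/=; exact: trig_setU.
  by rewrite big_ord0 /trig_set indic0; exact: trig_bounded_cst.
apply: (@trig_bounded_lim (fun n => \1_(U n)) _ 1) => //.
  by move=> n x; rewrite indicE; case: (_ \in _); rewrite ?normr1 ?normr0.
move=> x; have [[N _ AN]|nA] := pselect ((\bigcup_n A n) x).
  apply: cvg_near_cst; near=> n.
  rewrite !indicE !mem_set//; first by exists N.
  rewrite /U -bigcup_mkord; exists N => //=.
  by near: n; exact: nbhs_infty_gt.
apply: cvg_near_cst; near=> n.
rewrite !indicE !memNset//.
by rewrite /U -bigcup_mkord => -[i _ Ai]; apply: nA; exists i.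
Unshelve. all: by end_near.
Qed.

Lemma trig_set_gt f c : trig_bounded f -> trig_set [set x | c < f x].
Proof.
move=> fK; rewrite /trig_set (_ : \1__ = fun x => (0 < f x - c)%R%:R).
  apply: (trig_bounded_pos (f := f \- (fun=> c))); apply: trig_boundedB => //.
  exact: trig_bounded_cst.
apply/funext => x; rewrite indicE subr_gt0; congr (_%:R); congr nat_of_bool.
by apply/idP/idP => [/set_mem|?]; [|apply/mem_set].
Qed.

Lemma trig_bounded_cos : trig_bounded (fun x => cos (2 * pi * x)).
Proof.
split; last by exists 1 => x; rewrite ler_norml cos_geN1 cos_le1.
rewrite (_ : (fun _ => _) = trigpoly [:: (1, (2^-1)%:C); (-1, (2^-1)%:C)]).
  exact: trig_approx_trigpoly.
apply/funext => x; rewrite !trigpoly_cons trigpoly_nil addr0 /expi/= rmorphN/= rmorph1.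
rewrite mulrN mulNr mulr1 cosN sinN.
apply: complex_ext; rewrite ?(cReD, cImD, cReM, cImM)/=; last by ring.
by field.
Qed.

Lemma trig_bounded_sin : trig_bounded (fun x => sin (2 * pi * x)).
Proof.
split; last by exists 1 => x; rewrite ler_norml sin_geN1 sin_le1.
rewrite (_ : (fun _ => _) = trigpoly [:: (1, 0 -i* (2^-1)); (-1, 0 +i* (2^-1))]).
  exact: trig_approx_trigpoly.
apply/funext => x; rewrite !trigpoly_cons trigpoly_nil addr0 /expi/= rmorphN/= rmorph1.
rewrite mulrN mulNr mulr1 cosN sinN.
apply: complex_ext; rewrite ?(cReD, cImD, cReM, cImM)/=; last by ring.
by field.
Qed.

End bounded_trigonometric_closure.

(** * Density of trigonometric polynomials *)

Section unit_circle.
Context (R : realType).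
Implicit Types x y : R.

Lemma sin2pi_ge0 x : 0 <= x <= 2^-1 -> 0 <= sin (2 * pi * x).
Proof.
move=> /andP[x0 x1]; apply: sin_ge0_pi; have p0 := pi_gt0 R.
by apply/andP; split; nra.
Qed.

Lemma sin2pi_lt0 x : 2^-1 < x < 1 -> sin (2 * pi * x) < 0.
Proof.
move=> /andP[x0 x1]; have p0 := pi_gt0 R.
have -> : 2 * pi * x = 2 * pi * (x - 2^-1) + pi by field.
rewrite sinDpi oppr_lt0; apply: sin_gt0_pi.
by apply/andP; split; nra.
Qed.

Lemma ltr_cos2pi x y : 0 <= x <= 2^-1 -> 0 <= y <= 2^-1 ->
  (cos (2 * pi * x) < cos (2 * pi * y)) = (y < x).
Proof.
move=> /andP[x0 x1] /andP[y0 y1]; have p0 := pi_gt0 R.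
rewrite ltr_cos ?in_itv/=; first by rewrite ltr_pM2l// mulr_gt0.
- by apply/andP; split; nra.
- by apply/andP; split; nra.
Qed.

Lemma cos2pi_1B x : cos (2 * pi * (1 - x)) = cos (2 * pi * x).
Proof.
have -> : 2 * pi * (1 - x) = - (2 * pi * x) + pi *+ 2 by rewrite -mulr_natl; ring.
by rewrite cosD2pi cosN.
Qed.

End unit_circle.

Section trigonometric_density.
Context (R : realType).
Local Notation RT := (measurableTypeR R).
Variable nu : {measure set RT -> \bar R}.
Hypothesis nufin : (nu setT < +oo)%E.
Hypothesis nu01 : nu (~` [set` `[0 : R, 1 : R[]) = 0%E.

Lemma trig_approx_eq01 f g : trig_approx nu f -> cmeasurable g ->
  (forall x, 0 <= x < 1 -> f x = g x) -> trig_approx nu g.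
Proof.
move=> fK mg fg; apply: trig_approx_close => // e e0; exists f => //.
have [mf _] := fK.
suff -> : int_sqr nu (fun x => g x - f x) = 0%E by rewrite lee_fin ltW.
rewrite -[RHS](integral0 nu setT); apply: ae_eq_integral => //.
  by apply: cmeasurable_sqr_normc; exact: cmeasurableB.
exists (~` [set` `[0 : R, 1 : R[]); split => //.
  by apply: measurableC; exact: measurable_itv.
move=> x; apply: contra_not; rewrite /= in_itv/= => x01 _.
by rewrite fg// subrr normc0 expr0n.
Qed.

(** Only the trace on [0, 1) matters, since [nu] does not charge its complement. *)
Lemma trig_set_eq01 (A B : set RT) : trig_set nu A -> measurable B ->
  (forall x, 0 <= x < 1 -> A x <-> B x) -> trig_set nu B.
Proof.
move=> [AK _] mB AB; split; last first.
  by exists 1 => x; rewrite indicE; case: (_ \in _); rewrite ?normr1 ?normr0.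
apply: (trig_approx_eq01 AK); first exact: cmeasurable_real.
move=> x /(AB x) [ab ba]; rewrite !indicE; congr (_%:R)%:C; congr nat_of_bool.
by apply/idP/idP => /set_mem h; apply/mem_set; [exact: ab|exact: ba].
Qed.

Lemma trig_set_lt f c : trig_bounded nu f -> trig_set nu [set x | f x < c].
Proof.
move=> fK; rewrite (_ : [set x | _] = [set x | - c < -1 * f x]).
  by apply: trig_set_gt => //; exact: trig_boundedZ.
by apply/seteqP; split => x /=; rewrite mulN1r ltrN2.
Qed.

(** The sign of the sine tells in which half of [0, 1) a point lies, and the
    cosine is monotone on each half. Thus the trace of a ray on [0, 1) is a
    combination of level sets of [cos (2 * pi * x)] and [sin (2 * pi * x)]. *)
Lemma trig_set_ray (a : R) : trig_set nu `]a, +oo[%classic.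
Proof.
have sinlt : trig_set nu [set x | sin (2 * pi * x) < 0].
  by apply: trig_set_lt; exact: trig_bounded_sin.
have setT01 : trig_set nu setT.
  by rewrite /trig_set indicT; exact: trig_bounded_cst.
have [a0|a0] := ltP a 0.
  apply: (trig_set_eq01 setT01) => // x /andP[x0 x1]; split => // _.
  by rewrite /= in_itv/= andbT (lt_le_trans a0).
have [a1|a1] := leP a 2^-1.
  apply: (@trig_set_eq01 ([set x | cos (2 * pi * x) < cos (2 * pi * a)] `|`
    [set x | sin (2 * pi * x) < 0])) => //.
    by apply: trig_setU => //; apply: trig_set_lt; exact: trig_bounded_cos.
  move=> x /andP[x0 x1]; rewrite /= in_itv/= andbT.
  have [xh|xh] := leP x 2^-1.
    rewrite ltr_cos2pi ?x0 ?a0//; split; last by left.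
    by case=> //; rewrite ltNge sin2pi_ge0// x0.
  split; first by rewrite (le_lt_trans a1).
  by right; rewrite sin2pi_lt0// xh.
have [a2|a2] := leP 1 a.
  apply: (trig_set_eq01 (trig_setC setT01)) => // x /andP[x0 x1]; split => //=.
  by rewrite in_itv/= andbT => /lt_trans /(_ x1); rewrite ltNge a2.
apply: (@trig_set_eq01 ([set x | cos (2 * pi * a) < cos (2 * pi * x)] `&`
    [set x | sin (2 * pi * x) < 0])) => //.
  by apply: trig_setI => //; apply: trig_set_gt => //; exact: trig_bounded_cos.
move=> x /andP[x0 x1]; rewrite /= in_itv/= andbT.
have [xh|xh] := leP x 2^-1.
  split; first by move=> [_]; rewrite ltNge sin2pi_ge0// x0.
  by move=> /(lt_trans a1); rewrite ltNge xh.
rewrite sin2pi_lt0 ?xh// -(cos2pi_1B a) -(cos2pi_1B x) ltr_cos2pi.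
- by split => [[]|]; [lra|move=> h; split => //; lra].
- by apply/andP; split; lra.
- by apply/andP; split; lra.
Qed.

(** The rays generate the Borel sets. *)
Lemma trig_set_measurable (A : set RT) : measurable A -> trig_set nu A.
Proof.
move=> mA.
have : <<s @RGenOInfty.G R >> A.
  by rewrite -[X in X A]RGenOInfty.measurableE.
apply: smallest_sub; last by move=> _ [a ->]; exact: trig_set_ray.
split.
- by rewrite /trig_set indic0; exact: trig_bounded_cst.
- by move=> B BK; rewrite setTD; exact: trig_setC.
- by move=> F FK; exact: trig_set_bigcup.
Qed.

Import HBNNSimple.

(** Simple functions increasing to [f] stay below [f], which dominates the
    error. *)
Lemma trig_approx_nonneg (f : R -> R) : measurable_fun (setT : set RT) f ->
  (forall x, 0 <= f x) -> (\int[nu]_x (f x ^+ 2)%:E < +oo)%E ->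
  trig_approx nu (fun x => (f x)%:C).
Proof.
move=> mf f0 f2.
have mEf : measurable_fun (setT : set RT) (EFin \o f) by exact/measurable_EFinP.
pose f_ := nnsfun_approx measurableT mEf.
have Ef0 x : setT x -> (0 <= (EFin \o f) x)%E by rewrite lee_fin.
have fle n (x : RT) : f_ n x <= f x.
  by rewrite -lee_fin /f_ nnsfun_approxE; apply: (le_approx n Ef0).
apply: (@trig_approx_lim _ nu (fun n (x : R) => (f_ n x)%:C) _ (fun x => f x ^+ 2)).
- move=> n.
  have : trig_bounded nu (f_ n); last by case.
  rewrite (_ : f_ n = (fun x => \sum_(y <- finmap.enum_fset (fset_set (range (f_ n))))
      y * \1_(f_ n @^-1` [set y]) x) :> (R -> R)).
    apply: trig_bounded_sum => y; apply: trig_boundedZ.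
    exact: trig_set_measurable.
  by apply/funext => x; rewrite fimfunE fsbig_finite.
- exact: cmeasurable_real.
- move=> x; under eq_fun do rewrite -rmorphB normc_real.
  rewrite -(normr0 R) -[X in `|X|](subrr (f x)); apply: cvg_norm.
  apply: cvgB; first exact: cvg_cst.
  have := cvg_nnsfun_approx measurableT mEf Ef0 (x := x) Logic.I.
  by move/fine_cvg.
- apply/integrableP; split.
    by apply/measurable_EFinP; exact: measurable_funX.
  by under eq_integral => x _ do rewrite gee0_abs ?lee_fin ?sqr_ge0//.
- move=> n x; rewrite -rmorphB normc_real ler_sqr ?nnegrE//.
  by rewrite ger0_norm ?subr_ge0// lerBlDr lerDl.
Qed.

End trigonometric_density.

Section combinations.
Context (R : realType) (V : normedModType R[i]).

Lemma nrm2_ZD a (u v : V) :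
  nrm2 (a *: u + v) <= 2 * normc a ^+ 2 * nrm2 u + 2 * nrm2 v.
Proof.
rewrite /nrm2.
have : complex.Re `|a *: u + v| <= normc a * complex.Re `|u| + complex.Re `|v|.
  rewrite -lecR rmorphD rmorphM/= !normcr_Re.
  by rewrite (le_trans (ler_normD _ _))// normrZ.
have : 0 <= complex.Re `|a *: u + v| by rewrite -ler0c normcr_Re.
move: (complex.Re `|a *: u + v|) (complex.Re `|u|) (complex.Re `|v|) (normc a).
move=> r p q c r0 h; have h2 : r ^+ 2 <= (c * p + q) ^+ 2.
  by rewrite ler_sqr ?nnegrE// (le_trans r0).
apply: le_trans h2 _; have := sqr_ge0 (c * p - q); lra.
Qed.

Definition lcomb (e : int -> V) (s : seq (int * R[i])) : V :=
  \sum_(p <- s) p.2 *: e p.1.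

(** Gathering the coefficients of each frequency, to get the distinct indices
    that orthonormality and frame inequalities require. *)
Lemma lcomb_collect (e : int -> V) (s : seq (int * R[i])) :
  lcomb e s = \sum_(n <- undup (map fst s)) (\sum_(p <- s | p.1 == n) p.2) *: e n.
Proof.
under eq_bigr do rewrite scaler_suml.
rewrite (exchange_big_dep predT)//= /lcomb; apply: eq_big_seq => p ps.
rewrite (eq_bigl (fun n => n == p.1)); last by move=> n; rewrite eq_sym.
by rewrite -big_filter filter_pred1_uniq ?undup_uniq ?mem_undup ?map_f// big_seq1.
Qed.

End combinations.

Section exponentials_in_L2.
Context (R : realType).
Local Notation RT := (measurableTypeR R).
Variable nu : {measure set RT -> \bar R}.
Hypothesis nufin : (nu setT < +oo)%E.

Lemma expi_sqint (n : int) : expi n \in sqintegrable nu.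
Proof.
have [m1 m2] := @cmeasurable_expi R n; apply: square_integrableP => //.
under eq_integral => x _ do rewrite normc_expi expr1n.
by rewrite integral_cst// mul1e.
Qed.

(** The exponentials in L2 of a finite measure; for a probability measure this
    is [expi_L2], see [expi_L2E]. *)
Definition expi_class (n : int) : L2 nu := \pi_(L2 nu) (MkL2fun (expi_sqint n)).

Lemma L2dot_expi_class m n :
  L2dot (expi_class m) (expi_class n) = cintegral nu (expi (m - n)).
Proof.
rewrite L2dot_pi; congr cintegral; apply/funext => x.
by rewrite expiD -conj_expi.
Qed.

Lemma lcomb_expi_class s :
  exists F : L2fun nu, (forall x, F x = trigpoly s x) /\ \pi_(L2 nu) F = lcomb expi_class s.
Proof.
elim: s => [|p s [F [FE piF]]].
  exists 0; split; first by move=> x; rewrite trigpoly_nil.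
  by rewrite /lcomb big_nil; exact: (@pi_zeror _ _ _ _ _ (Quotient.quot (@aenull _ _ _ nu))).
exists (p.2 *: MkL2fun (expi_sqint p.1) + F); split.
  by move=> x; rewrite trigpoly_cons -FE.
by rewrite pi_L2ZD piF /lcomb big_cons.
Qed.

Lemma nrm2_sub_lcomb (f : L2fun nu) s :
  ((nrm2 (\pi_(L2 nu) f - lcomb expi_class s))%:E =
    int_sqr nu (fun x => f x - trigpoly s x)%R)%E.
Proof.
have [F [FE <-]] := lcomb_expi_class s.
rewrite addrC -scaleN1r -pi_L2ZD L2nrm2E; apply: eq_integral => x _.
congr (normc _ ^+ 2)%:E.
by rewrite -FE -[LHS]/(-1 * F x + f x) mulN1r addrC.
Qed.

Hypothesis nu01 : nu (~` [set` `[0 : R, 1 : R[]) = 0%E.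

Lemma lcomb_expi_class_dense (f : L2 nu) (eps : R) : 0 < eps ->
  exists s, nrm2 (f - lcomb expi_class s) <= eps.
Proof.
move: f eps; apply: L2_nonneg_ind => [a f g fP gP eps e0|f fIm fRe eps e0].
  have e1 : 0 < eps / (4 * (normc a ^+ 2 + 1)).
    by rewrite divr_gt0// mulr_gt0// ltr_wpDl// sqr_ge0.
  have e2 : 0 < eps / 4 by rewrite divr_gt0.
  have [s sP] := fP _ e1; have [t tP] := gP _ e2.
  exists ([seq (p.1, a * p.2) | p <- s] ++ t).
  have -> : lcomb expi_class ([seq (p.1, a * p.2) | p <- s] ++ t) =
      a *: lcomb expi_class s + lcomb expi_class t.
    rewrite /lcomb big_cat big_map/= scaler_sumr; congr (_ + _).
    by apply: eq_bigr => p _; rewrite scalerA.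
  rewrite opprD addrACA -scalerBr.
  apply: le_trans (nrm2_ZD _ _ _) _.
  have a1 : 0 < normc a ^+ 2 + 1 by rewrite ltr_wpDl// sqr_ge0.
  have : 2 * normc a ^+ 2 * nrm2 (f - lcomb expi_class s) <= eps / 2.
    apply: le_trans (ler_wpM2l _ sP) _; first by rewrite mulr_ge0 ?sqr_ge0.
    rewrite [X in _ <= X](_ : _ = 2 * (normc a ^+ 2 + 1) * (eps / (4 * (normc a ^+ 2 + 1)))).
      by rewrite ler_wpM2r ?(ltW e1)// ler_wpM2l// lerDl.
    by field; rewrite gt_eqF.
  by move: tP; lra.
have [mRe mIm] := (L2fun_measurable_Re f, L2fun_measurable_Im f).
have [_ /(_ _ e0) [s sP]] := trig_approx_nonneg nufin nu01 mRe fRe (L2fun_Re_lty f).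
exists s; rewrite -lee_fin nrm2_sub_lcomb; apply: le_trans sP.
rewrite le_eqVlt; apply/orP; left; apply/eqP; apply: eq_integral => x _.
by congr ((normc (_ - _) ^+ 2)%:E); apply: complex_ext => //=; exact: fIm.
Qed.

End exponentials_in_L2.

(** * Fourier series on [0, 1) *)

Section fourier.
Context (R : realType).
Local Notation RT := (measurableTypeR R).
Local Notation lam := (lebesgue01 R).

Lemma lebesgue01_setT : lam setT = 1%E.
Proof.
rewrite /lebesgue01 /= /mrestr setTI.
by rewrite lebesgue_measure_itv/= lte_fin ltr01 sube0.
Qed.

Lemma lebesgue01_lty : (lam setT < +oo)%E.
Proof. by rewrite lebesgue01_setT ltry. Qed.

Lemma lebesgue01C : lam (~` [set` `[0 : R, 1 : R[]) = 0%E.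
Proof. by rewrite /lebesgue01 /= /mrestr setICl measure0. Qed.

Lemma integral_lebesgue01 (f : R -> R) : continuous f ->
  lam.-integrable setT (EFin \o f) ->
  (\int[lam]_x (f x)%:E = \int[lebesgue_measure]_(x in `[0%R, 1%R]) (f x)%:E)%E.
Proof.
move=> cf fi.
have mC : measurable (~` [set` `[0 : R, 1 : R[] : set RT).
  by apply: measurableC; exact: measurable_itv.
rewrite (negligible_integral mC measurableT fi lebesgue01C).
rewrite setTD setCK -integral_itv_bndo_bndc; last first.
  apply/measurable_EFinP; apply: measurable_funTS.
  exact: continuous_measurable_fun.
apply: eq_measure_integral => A mA A01.
by rewrite /lebesgue01 /= /mrestr setIidl.
Qed.

Lemma integrable_lebesgue01 (f : R -> R) (M : R) : continuous f ->
  (forall x, `|f x| <= M) -> lam.-integrable setT (EFin \o f).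
Proof.
move=> cf fM; apply: (@le_integrable _ _ _ lam setT measurableT _ (EFin \o cst M)).
- by apply/measurable_EFinP; exact: continuous_measurable_fun.
- by move=> x _ /=; rewrite lee_fin (le_trans (fM x)) ?ler_norm.
- apply/integrableP; split; first by apply/measurable_EFinP; exact: measurable_cst.
  under eq_integral do rewrite /=.
  by rewrite integral_cst// lebesgue01_setT mule1 ltry.
Qed.

Lemma integral_deriv01 (f F : R -> R) (M : R) : continuous f ->
  (forall x, `|f x| <= M) -> (forall x : R, is_derive x 1 F (f x)) -> F 0 = F 1 ->
  (\int[lam]_x (f x)%:E = 0)%E.
Proof.
move=> cf fM dF F01; rewrite integral_lebesgue01//; last exact: integrable_lebesgue01 fM.
have cF : continuous F.
  move=> x; apply: differentiable_continuous; apply/derivable1_diffP.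
  by have [] := dF x.
rewrite (@continuous_FTC2 _ f F)//.
- by rewrite F01 subee.
- by apply: continuous_subspaceT.
- split.
  + by move=> x _; have [] := dF x.
  + by apply: cvg_at_right_filter; exact: cF.
  + by apply: cvg_at_left_filter; exact: cF.
- by move=> x _; rewrite derive1E; have [_ ->] := dF x.
Qed.

Lemma cintegral_expi (k : int) : cintegral lam (expi k) = (k == 0)%:R.
Proof.
have [->|k0] := eqVneq k 0.
  rewrite (_ : expi 0 = fun=> 1); last by apply/funext => x; exact: expi0.
  apply: complex_ext; rewrite /= /Rintegral.
    by rewrite integral_cst//= lebesgue01_setT mule1.
  by rewrite integral0.
have c0 : 2 * pi * k%:~R != 0 :> R.
  by rewrite !mulf_neq0 ?intr_eq0// gt_eqF// pi_gt0.
pose c : R := 2 * pi * k%:~R; rewrite -/c in c0.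
have lin : continuous (fun x : R => c * x) by move=> x; exact: mulrl_continuous.
have dlin (x : R) : is_derive x 1 (fun x : R => c * x) c.
  by rewrite -[X in is_derive _ _ _ X](mulr1 c); exact: is_deriveZ.
have trig1 : sin c = 0 /\ cos c = 1.
  have per (n : nat) : sin (2 * pi * n%:R) = 0 :> R /\ cos (2 * pi * n%:R) = 1 :> R.
    rewrite (_ : 2 * pi * n%:R = 0 + (pi *+ 2) *+ n); last first.
      by rewrite add0r -[RHS]mulr_natr -[pi *+ 2]mulr_natl.
    by rewrite (periodicn (@sinD2pi R)) (periodicn (@cosD2pi R)) sin0 cos0.
  rewrite /c; case: (k) => n; first exact: (per n).
  by rewrite NegzE rmorphN/= mulrN sinN cosN; have [-> ->] := per n.+1; rewrite oppr0.
have Icos : (\int[lam]_x (cos (c * x))%:E = 0)%E.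
  apply: (@integral_deriv01 _ (fun x => c^-1 * sin (c * x)) 1).
  - by move=> x; exact: (continuous_comp (lin x) (@continuous_cos R _)).
  - by move=> x; rewrite ler_norml cos_geN1 cos_le1.
  - move=> x; rewrite (_ : cos (c * x) = c^-1 *: (cos (c * x) * c)).
      exact: is_deriveZ.
    by rewrite -[RHS]/(c^-1 * (cos (c * x) * c)) mulrCA mulVf// mulr1.
  - by rewrite mulr0 sin0 mulr1 trig1.1 mulr0.
have Isin : (\int[lam]_x (sin (c * x))%:E = 0)%E.
  apply: (@integral_deriv01 _ (fun x => - c^-1 * cos (c * x)) 1).
  - by move=> x; exact: (continuous_comp (lin x) (@continuous_sin R _)).
  - by move=> x; rewrite ler_norml sin_geN1 sin_le1.
  - move=> x; rewrite (_ : sin (c * x) = (- c^-1) *: (- sin (c * x) * c)).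
      exact: is_deriveZ.
    by rewrite -[RHS]/(- c^-1 * (- sin (c * x) * c)) mulrCA !mulNr mulVf// mulrN1 opprK.
  - by rewrite mulr0 cos0 mulr1 trig1.2.
by apply: complex_ext; rewrite /= /Rintegral ?Icos ?Isin.
Qed.

Local Notation e := (expi_class lebesgue01_lty).

Lemma expi_class_orthonormal m n : L2dot (e m) (e n) = (m == n)%:R.
Proof. by rewrite L2dot_expi_class cintegral_expi subr_eq0. Qed.

(** The exponentials are orthonormal for Lebesgue measure and their span is
    dense. *)
Lemma fourier_parseval : parseval_frame (@L2dot _ _ _ lam) e.
Proof.
apply: parseval_of_dense.
- exact: L2dotZDl.
- exact: L2dotC.
- exact: L2dot_norm.
- exact: expi_class_orthonormal.
move=> f eps e0; have [s sP] := lcomb_expi_class_dense lebesgue01_lty lebesgue01C f e0.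
exists (undup (map fst s)), (fun n => \sum_(p <- s | p.1 == n) p.2).
by rewrite undup_uniq -lcomb_collect.
Qed.

End fourier.

(** * Singular measures *)

Section singular_case.
Context (R : realType).
Local Notation RT := (measurableTypeR R).
Local Notation lam := (lebesgue01 R).

Lemma probability_itv01C (mu : probability RT R) :
  mu `[0%R, 1%R[%classic = 1%E -> mu (~` [set` `[0 : R, 1 : R[]) = 0%E.
Proof.
move=> mu01; rewrite probability_setC; last exact: measurable_itv.
by rewrite [X in (1 - X)%E]mu01 subee.
Qed.

Lemma probability_lty (mu : probability RT R) : (mu setT < +oo)%E.
Proof. by rewrite probability_setT ltry. Qed.

Lemma expi_L2E (mu : probability RT R) n : expi_L2 mu n = expi_class (probability_lty mu) n.
Proof. by congr (\pi_(L2 mu) _); exact: val_inj. Qed.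

Lemma lcomb_lspan (V : normedModType R[i]) (e : int -> V) s : lspan e (lcomb e s).
Proof.
by rewrite lcomb_collect; do 2 eexists; reflexivity.
Qed.

Lemma linear_on_lcomb (V : normedModType R[i]) (e : int -> V) (B : V -> V) s :
  linear_on (lspan e) B -> B (lcomb e s) = lcomb (B \o e) s.
Proof.
move=> lB.
have B0 : B 0 = 0.
  have h0 : lspan e 0 by exists [::], (fun=> 0); rewrite big_nil.
  have := lB 1 0 0 h0 h0; rewrite !scale1r addr0 => /eqP.
  by rewrite -[X in X == _]addr0 (inj_eq (addrI _)) => /eqP.
elim: s => [|p s ih]; first by rewrite /lcomb !big_nil.
rewrite /lcomb !big_cons -!/(lcomb _ _) lB ?ih//; last exact: lcomb_lspan.
by exists [:: p.1], (fun=> 1); rewrite big_seq1 scale1r.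
Qed.

(** Sending [expi n] to [h n] contracts the norm of L2([0, 1)]: by
    orthonormality this norm is the l2 norm of the coefficients, and the
    synthesis operator of a Parseval frame is a contraction. *)
Lemma parseval_lcomb_le (mu : {measure set RT -> \bar R}) (h : int -> L2 mu) s :
  parseval_frame (@L2dot _ _ _ mu) h ->
  nrm2 (lcomb h s) <= nrm2 (lcomb (expi_class (lebesgue01_lty R)) s).
Proof.
move=> ph; rewrite !lcomb_collect.
rewrite (@nrm2_sum _ _ (@L2dot _ _ _ lam))//; last exact: undup_uniq.
- apply: (@parseval_synthesis _ _ (@L2dot _ _ _ mu)) => //.
  + exact: L2dotZDl.
  + exact: L2dotC.
  + exact: L2dot_norm.
  + exact: undup_uniq.
- exact: L2dotZDl.
- exact: L2dotC.
- exact: L2dot_norm.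
- exact: expi_class_orthonormal.
Qed.

Lemma eq_int_sqr_ae (nu : {measure set RT -> \bar R}) (A : set RT) f g :
  measurable A -> nu A = 0%E -> cmeasurable f -> cmeasurable g ->
  (forall x, ~ A x -> f x = g x) -> int_sqr nu f = int_sqr nu g.
Proof.
move=> mA A0 mf mg fg; apply: ae_eq_integral => //.
- exact: cmeasurable_sqr_normc.
- exact: cmeasurable_sqr_normc.
exists A; split => // x; apply: contra_notP => nAx _.
by rewrite fg.
Qed.

(** If [N] is Lebesgue null and [mu] is carried by [N], then the function
    [\1_(~` N) * expi m] vanishes [mu]-almost everywhere and equals [expi m]
    Lebesgue-almost everywhere. A trigonometric polynomial close to it for
    the sum of the two measures is close to [0] in L2(mu) and to [expi m] in
    L2([0, 1)). *)
Lemma singular_separation (mu : probability RT R) (m : int) (eps : R) :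
  mu `[0%R, 1%R[%classic = 1%E -> mutually_singular mu lam -> 0 < eps ->
  exists s, nrm2 (lcomb (expi_L2 mu) s) <= eps /\
    nrm2 (expi_class (lebesgue01_lty R) m -
          lcomb (expi_class (lebesgue01_lty R)) s) <= eps.
Proof.
move=> mu01 [N [mN muN lamN]] e0.
pose nu : {measure set RT -> \bar R} := measure_add mu lam.
have nuE A : nu A = (mu A + lam A)%E by exact: measure_addE.
have nufin : (nu setT < +oo)%E.
  by rewrite nuE probability_setT lebesgue01_setT ltry.
have nu01 : nu (~` [set` `[0 : R, 1 : R[]) = 0%E.
  by rewrite nuE probability_itv01C// lebesgue01C adde0.
have mCN : measurable (~` N) by exact: measurableC.
have [indK _] := trig_set_measurable nufin nu01 mCN.
have [mh hK] := trig_approxZ 1 m indK.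
have [s sP] := hK _ e0; exists s.
have ms := cmeasurable_trigpoly s.
have md : cmeasurable (fun x => 1 * (expi m x * (\1_(~` N) x)%:C) - trigpoly s x).
  exact: cmeasurableB.
have mexp := @cmeasurable_expi R m.
rewrite /int_sqr ge0_integral_measure_add// in sP; first last.
- exact: cmeasurable_sqr_normc.
- by move=> x _; rewrite lee_fin sqr_ge0.
rewrite -!/(int_sqr _ _) in sP.
split.
- rewrite -lee_fin; apply: le_trans sP.
  apply: le_trans (leeDl _ (int_sqr_ge0 _ _)).
  rewrite (eq_int_sqr_ae (f := fun x => 1 * (expi m x * (\1_(~` N) x)%:C) - trigpoly s x)
     (g := fun x => 0 - trigpoly s x) mCN muN)//; first last.
  + by move=> x nNx; rewrite indicE memNset// mulr0 mulr0.
  + by apply: cmeasurableB => //; exact: cmeasurable_cst.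
  have -> : expi_L2 mu = expi_class (probability_lty mu).
    by apply/funext => n; exact: expi_L2E.
  rewrite /nrm2 -normrN -[- lcomb _ _]sub0r -/(nrm2 _).
  rewrite -[X in X - _](@pi_zeror _ _ _ _ _ (Quotient.quot (@aenull _ _ _ mu))).
  by rewrite nrm2_sub_lcomb.
- rewrite -lee_fin nrm2_sub_lcomb; apply: le_trans sP.
  apply: le_trans (leeDr _ (int_sqr_ge0 _ _)).
  rewrite (eq_int_sqr_ae (f := fun x => 1 * (expi m x * (\1_(~` N) x)%:C) - trigpoly s x)
     (g := fun x => expi m x - trigpoly s x) mN lamN)//.
  + by apply: cmeasurableB.
  + by move=> x nNx; rewrite indicE mem_set// mulr1 mul1r.
Qed.

Lemma ball_nrm2 (V : normedModType R[i]) (x y : V) (eps : R[i]) : 0 < eps ->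
  nrm2 (x - y) <= (complex.Re eps / 2) ^+ 2 -> ball x eps y.
Proof.
move=> e0 h; rewrite -ball_normE /ball_/=.
have eE : eps = (complex.Re eps)%:C by rewrite RRe_real// gtr0_real.
have r0 : 0 < complex.Re eps by rewrite eE ltcR in e0.
rewrite eE -normcr_Re ltcR; rewrite /nrm2 ler_sqr ?nnegrE in h.
(* Halving eps turns the hypothesis into the strict inequality of a ball. *)
- by apply: le_lt_trans h _; lra.
- by rewrite -ler0c normcr_Re.
- lra.
Qed.

(** Some [B e_m] is nonzero, since the frame reproduces the norm of [e_0]. The
    polynomials of [singular_separation] tend to [0] in L2(mu), while their
    images tend to [B e_m] because [B] contracts the norm of L2([0, 1)). So
    the closure of the graph contains [(0, B e_m)] besides [(0, 0)]. *)
Theorem singular_not_closable (mu : probability RT R) (B : L2 mu -> L2 mu) :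
  mu `[0%R, 1%R[%classic = 1%E -> mutually_singular mu lam ->
  linear_on (lspan (expi_L2 mu)) B ->
  parseval_frame (@L2dot _ _ _ mu) (fun n => B (expi_L2 mu n)) ->
  ~ closable (lspan (expi_L2 mu)) B.
Proof.
move=> mu01 sing lB pB.
pose e := expi_L2 mu; pose el := expi_class (lebesgue01_lty R).
have [m Bm] : exists m, B (e m) != 0.
  apply/not_existsP => B0.
  have := pB (e 0); rewrite esum1; last first.
    move=> n _; move: (B0 n) => /negP/negPn/eqP ->.
    rewrite (L2dotC 0) (@dot0l _ _ (@L2dot _ _ _ mu)) ?conjc0 ?normc0 ?expr0n//.
    exact: L2dotZDl.
  rewrite -/(nrm2 _) /e expi_L2E L2nrm2E.
  under eq_integral => x _ do rewrite normc_expi expr1n.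
  rewrite integral_cst// mul1e [RHS](@probability_setT _ _ _ mu) => /eqP.
  by rewrite eqe eq_sym oner_eq0.
move=> [D' [B' [[D0 _] _ clE]]].
have in0 : graph_on (lspan e) B (0, B 0).
  by split => //; exists [::], (fun=> 0); rewrite big_nil.
have B0 : B 0 = 0.
  have := linear_on_lcomb [::] lB; rewrite /lcomb !big_nil.
  by [].
have : closure (graph_on (lspan e) B) (0, B (e m)).
  move=> U [[U1 U2] /= [/nbhs_ballP[r1 r10 r1U] /nbhs_ballP[r2 r20 r2U]] U12].
  pose r := Num.min (complex.Re r1) (complex.Re r2).
  have Re0 (z : R[i]) : 0 < z -> 0 < complex.Re z.
    by move=> z0; rewrite -ltcR RRe_real// gtr0_real.
  have r0 : 0 < r by rewrite lt_min !Re0.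
  have e0 : 0 < (r / 2) ^+ 2 by rewrite exprn_gt0// divr_gt0.
  have rle (z : R[i]) : 0 < z -> r <= complex.Re z -> (r / 2) ^+ 2 <= (complex.Re z / 2) ^+ 2.
    by move=> z0 rz; rewrite ler_sqr ?nnegrE ?divr_ge0 ?(ltW r0) ?(ltW (Re0 _ z0))// ler_pM2r.
  have [s [s1 s2]] := singular_separation m mu01 sing e0.
  exists (lcomb e s, B (lcomb e s)); split; first by split => //; exact: lcomb_lspan.
  apply: U12; split => /=.
  - apply: r1U; apply: ball_nrm2 => //; rewrite sub0r /nrm2 normrN -/(nrm2 _).
    by apply: le_trans s1 _; apply: rle => //; rewrite ge_min lexx.
  - apply: r2U; apply: ball_nrm2 => //.
    have -> : B (e m) - B (lcomb e s) = lcomb (B \o e) ((m, 1) :: [seq (p.1, - p.2) | p <- s]).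
      rewrite /lcomb big_cons scale1r linear_on_lcomb// big_map; congr (_ + _).
      by rewrite /lcomb -sumrN; apply: eq_bigr => p _; rewrite scaleNr.
    apply: le_trans (parseval_lcomb_le _ pB) _.
    have -> : lcomb el ((m, 1) :: [seq (p.1, - p.2) | p <- s]) = el m - lcomb el s.
      rewrite /lcomb big_cons scale1r big_map; congr (_ + _).
      by rewrite /lcomb -sumrN; apply: eq_bigr => p _; rewrite scaleNr.
    by apply: le_trans s2 _; apply: rle => //; rewrite ge_min lexx orbT.
rewrite clE => -[/= _ Bm'].
have := subset_closure in0; rewrite clE => -[/= _ B0'].
by move: Bm; rewrite Bm' -B0' B0 eqxx.
Qed.

End singular_case.

(** * A set where the measure is comparable to Lebesgue measure *)

Section radon_nikodym_density.
Context d (T : measurableType d) (R : realType).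
Implicit Types mu nu : {measure set T -> \bar R}.

Lemma finite_measure_pack mu : (mu setT < +oo)%E ->
  exists mf : {finite_measure set T -> \bar R}, forall A, mf A = mu A.
Proof.
move=> mufin.
exists (mfrestr measurableT mufin) => A.
by rewrite -[LHS]/(mu (A `&` setT)) setIT.
Qed.

(** A form of the Radon-Nikodym theorem that integrates nonnegative functions
    instead of measuring sets, so that densities combine with products and with
    changes of variables. *)
Lemma density_ex mu nu : (mu setT < +oo)%E -> (nu setT < +oo)%E -> nu `<< mu ->
  exists g : T -> R, [/\ measurable_fun setT g, forall x, 0 <= g x &
    forall f : T -> \bar R, (forall x, (0 <= f x)%E) -> measurable_fun setT f ->
      (\int[nu]_x f x = \int[mu]_x (f x * (g x)%:E))%E].
Proof.
move=> mufin nufin numu.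
have [mf mfE] := finite_measure_pack mufin.
have [nf nfE] := finite_measure_pack nufin.
have nm : nf `<< mf.
  move/null_content_dominatesP : numu => h; apply/null_content_dominatesP => A mA mfA0.
  exact: (etrans (nfE A) (h A mA (etrans (esym (mfE A)) mfA0))).
pose g := Radon_Nikodym_SigmaFinite.f nf mf.
have gfin x : g x \is a fin_num by exact: Radon_Nikodym_SigmaFinite.f_fin_num.
have mg : measurable_fun setT g.
  exact: measurable_int (Radon_Nikodym_SigmaFinite.f_integrable nm).
exists (fine \o g); split.
- by apply: measurableT_comp.
- by move=> x; apply: fine_ge0; exact: Radon_Nikodym_SigmaFinite.f_ge0.
move=> f f0 mf'.
rewrite (@eq_measure_integral _ _ _ setT nf nu); last by move=> A _ _; exact/esym/nfE.
rewrite -(Radon_Nikodym_SigmaFinite.change_of_variables nm)//.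
rewrite (@eq_measure_integral _ _ _ setT mu mf); last by move=> A _ _; exact: mfE.
by apply: eq_integral => x _ /=; rewrite fineK.
Qed.

End radon_nikodym_density.

Section comparable_set.
Context (R : realType).
Local Notation RT := (measurableTypeR R).
Local Notation lam := (lebesgue01 R).

(** Let [g] be the Lebesgue density of the absolutely continuous part and [N] a
    Lebesgue null set carrying the singular part. Off [N] the measure [mu] has
    density [g]. The sets where [g] lies between [n.+1%:R^-1] and [n.+1%:R]
    exhaust the set where [g] is positive, so they cannot all be null unless
    the absolutely continuous part is zero. *)
Lemma comparable_set_ex (mu : probability RT R) : has_ac_part mu lam ->
  exists (A : set RT) (k : R), [/\ measurable A, 0 < k, lam A != 0%E &
    forall E, measurable E -> E `<=` A ->
      (mu E <= k%:E * lam E)%E /\ (lam E <= k%:E * mu E)%E].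
Proof.
move=> [mua [mus [[ac [N [mN musN lamN]] muE] mua0]]].
have mua_fin : (mua setT < +oo)%E.
  apply: (@le_lt_trans _ _ (mu setT)); last by rewrite probability_setT ltry.
  by rewrite muE// leeDl.
have [g [mg g0 gE]] := density_ex (lebesgue01_lty R) mua_fin ac.
have muaE E : measurable E -> mua E = (\int[lam]_(x in E) (g x)%:E)%E.
  move=> mE; rewrite -[LHS]mul1e -integral_cst// integral_mkcond.
  rewrite gE.
  - rewrite [RHS]integral_mkcond; apply: eq_integral => x _.
    by rewrite /patch; case: ifP; rewrite ?mul1e ?mul0e.
  - by move=> x; rewrite /patch; case: ifP.
  - by apply/(measurable_restrictT _ _).1.
pose A_ n := [set x : RT | n.+1%:R^-1 <= g x <= n.+1%:R] `&` ~` N.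
have mA n : measurable (A_ n).
  apply: measurableI; last exact: measurableC.
  rewrite (_ : [set x | _] = g @^-1` `[n.+1%:R^-1, n.+1%:R]).
    by rewrite -[X in measurable X]setTI; exact: mg.
  by apply/seteqP; split => x /=; rewrite in_itv.
have [n An0] : exists n, lam (A_ n) != 0%E.
  apply/not_existsP => h0.
  have A0 n : lam (A_ n) = 0%E by move: (h0 n) => /negP/negPn/eqP.
  pose U : set RT := \bigcup_n A_ n `|` N.
  have mU : measurable U by apply: measurableU => //; exact: bigcup_measurable.
  have lamU : lam U = 0%E.
    rewrite measureU0//; last exact: bigcup_measurable.
    apply/eqP; rewrite eq_le measure_ge0 andbT.
    have mUA : measurable (\bigcup_n A_ n) by exact: bigcup_measurable.
    apply: le_trans (measure_sigma_subadditive lam mA mUA (@subset_refl _ _)) _.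
    by rewrite eseries0// => n _ _; exact: A0.
  have muaU : mua U = 0%E by move/null_content_dominatesP : ac; exact.
  have muaCU : mua (~` U) = 0%E.
    rewrite muaE; last exact: measurableC.
    apply: integral0_eq => x nUx; congr EFin.
    have [//|gx0] := leP (g x) 0; first by move=> gx; apply/eqP; rewrite eq_le gx g0.
    exfalso; apply: nUx; have [Nx|nNx] := pselect (N x); [by right|left].
    have [n [n1 n2]] : exists n : nat, n.+1%:R^-1 < g x /\ g x <= n%:R.
      near \oo%classic => n; exists n; split; near: n.
        exact: near_infty_natSinv_lt (PosNum gx0).
      exact: nbhs_infty_ger.
    exists n => //; split => //=; rewrite (ltW n1)/= (le_trans n2)// ler_nat.
    exact: leqnSn.
  have muaT : mua setT = (mua U + mua (~` U))%E.
    rewrite -measureU ?setUv ?setICr//; exact: measurableC.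
  by move: mua0; rewrite muaT muaU muaCU adde0 eqxx.
exists (A_ n), n.+1%:R; split => // E mE EA.
have muEE : mu E = mua E.
  rewrite muE// [X in (_ + X)%E](_ : _ = 0%E) ?adde0//.
  apply: (subset_measure0 mE _ _ musN) => //; first exact: measurableC.
  by move=> x /EA [].
have gA x : E x -> n.+1%:R^-1 <= g x <= n.+1%:R by move=> /EA[].
have mgE : measurable_fun E (EFin \o g).
  by apply/measurable_EFinP; exact: measurable_funTS.
rewrite muEE muaE//; split.
- rewrite -integral_cst//; apply: ge0_le_integral => //.
  + by move=> x _; rewrite lee_fin.
  + by move=> x Ex; rewrite lee_fin; case/andP: (gA _ Ex).
- rewrite -ge0_integralZl//; last by move=> x _; rewrite lee_fin.
  rewrite -[leLHS]mul1e -integral_cst//; apply: ge0_le_integral => //.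
  + exact: measurable_funeM.
  + move=> x Ex; rewrite -EFinM lee_fin; case/andP: (gA _ Ex) => h _.
    by rewrite -ler_pdivrMl// mulr1.
Unshelve. all: by end_near.
Qed.

End comparable_set.

(** * Weighted composition operators *)

Section integral_restriction.
Context d (T : measurableType d) (R : realType).
Variables (m : {measure set T -> \bar R}) (A : set T) (mA : measurable A).

Lemma ge0_integral_mrestr (f : T -> \bar R) : (forall x, (0 <= f x)%E) ->
  measurable_fun setT f ->
  (\int[mrestr m mA]_x f x = \int[m]_x ((\1_A x)%:E * f x))%E.
Proof.
move=> f0 mf.
have patchE : (fun x => ((\1_A x)%:E * f x)%E) = f \_ A.
  apply/funext => x; rewrite /patch indicE.
  by case: (x \in A); rewrite ?mul1e ?mul0e.
rewrite patchE -integral_mkcond.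
rewrite (@eq_measure_integral _ _ _ A (mrestr m mA) m); last first.
  by move=> E mE EA; rewrite -[RHS]/(m (E `&` A)) setIidl.
rewrite [RHS]integral_mkcond; apply: ae_eq_integral => //.
  by apply/(measurable_restrictT _ _).1 => //; exact: measurable_funTS.
exists (~` A); split; first exact: measurableC.
- by rewrite -[LHS]/(m (~` A `&` A)) setICl measure0.
- by move=> x; apply: contra_not => Ax _; rewrite /patch mem_set.
Qed.

End integral_restriction.

Lemma pushforward_measure_ex d1 d2 (T1 : measurableType d1) (T2 : measurableType d2)
    (R : realType) (m : {measure set T1 -> \bar R}) (phi : T1 -> T2) :
  measurable_fun setT phi -> exists2 m' : {measure set T2 -> \bar R},
    (forall E, m' E = m (phi @^-1` E)) &
    forall f : T2 -> \bar R, (forall x, (0 <= f x)%E) -> measurable_fun setT f ->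
      (\int[m']_x f x = \int[m]_x f (phi x))%E.
Proof.
move=> mphi.
pose pushed : {measure set T2 -> \bar R} := pushforward m phi.
exists (pushed mphi) => // f f0 mf.
exact: (ge0_integral_pushforward mphi m measurableT mf).
Qed.

(** The operator [f |-> w * (f \o phi)]. The inequality [wC] makes it bounded and
    independent of the representative of [f]. It yields below the restriction
    to a set, the extension by zero, and the transfer of functions along a
    measure-preserving map. *)
Section weighted_composition.
Context d1 d2 (T1 : measurableType d1) (T2 : measurableType d2) (R : realType).
Variables (m1 : {measure set T1 -> \bar R}) (m2 : {measure set T2 -> \bar R}).
Variables (phi : T2 -> T1) (w : T2 -> R) (C : R).
Hypotheses (mphi : measurable_fun setT phi) (mw : measurable_fun setT w).
Hypothesis wC : forall h : T1 -> \bar R, (forall x, (0 <= h x)%E) ->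
  measurable_fun setT h ->
  (\int[m2]_x ((w x ^+ 2)%:E * h (phi x)) <= C%:E * \int[m1]_x h x)%E.

Lemma weighted_int_sqr_le (f : L2fun m1) :
  (\int[m2]_x (normc ((w x)%:C * f (phi x)) ^+ 2)%:E <= C%:E * (nrm2 (\pi_(L2 m1) f))%:E)%E.
Proof.
rewrite L2nrm2E; apply: le_trans (wC _ _); last first.
- by apply/measurable_EFinP; apply: measurable_funX; exact: L2fun_measurable_normc.
- by move=> x; rewrite lee_fin sqr_ge0.
rewrite le_eqVlt; apply/orP; left; apply/eqP; apply: eq_integral => x _.
by rewrite normcM normc_real exprMn real_normK ?num_real.
Qed.

Lemma weighted_sqintegrable (f : L2fun m1) :
  (fun x => (w x)%:C * f (phi x)) \in sqintegrable m2.
Proof.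
have mRe := L2fun_measurable_Re f; have mIm := L2fun_measurable_Im f.
apply: square_integrableP.
- rewrite (_ : _ \o _ = w \* ((fun x => complex.Re (f x)) \o phi)).
    by apply: measurable_funM => //; exact: measurableT_comp.
  by apply/funext => x /=; case: (f (phi x)) => a b /=; rewrite mul0r subr0.
- rewrite (_ : _ \o _ = w \* ((fun x => complex.Im (f x)) \o phi)).
    by apply: measurable_funM => //; exact: measurableT_comp.
  by apply/funext => x /=; case: (f (phi x)) => a b /=; rewrite mul0r addr0.
- by apply: le_lt_trans (weighted_int_sqr_le f) _; rewrite -EFinM ltry.
Qed.

Definition weighted_fun (f : L2fun m1) : L2fun m2 := MkL2fun (weighted_sqintegrable f).

Definition weighted_op (f : L2 m1) : L2 m2 := \pi_(L2 m2) (weighted_fun (repr f)).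

Lemma weighted_fun_nrm2 f :
  nrm2 (\pi_(L2 m2) (weighted_fun f)) <= C * nrm2 (\pi_(L2 m1) f).
Proof. by rewrite -lee_fin L2nrm2E EFinM; exact: weighted_int_sqr_le. Qed.

Lemma weighted_funZD a f g :
  weighted_fun (a *: f + g) = a *: weighted_fun f + weighted_fun g.
Proof.
apply: val_inj; apply/funext => x.
rewrite -[LHS]/((w x)%:C * (a * f (phi x) + g (phi x))).
rewrite -[RHS]/(a * ((w x)%:C * f (phi x)) + (w x)%:C * g (phi x)).
by rewrite mulrDr mulrCA.
Qed.

Lemma weighted_op_pi f : weighted_op (\pi_(L2 m1) f) = \pi_(L2 m2) (weighted_fun f).
Proof.
rewrite /weighted_op; set g := repr _.
have gf : \pi_(L2 m1) g = \pi_(L2 m1) f by rewrite reprK.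
apply/eqP; rewrite -subr_eq0 -normr_eq0; apply/eqP.
rewrite -normcr_Re; apply/eqP; rewrite (_ : complex.Re _ = 0)//.
apply/eqP; rewrite -sqrf_eq0 -/(nrm2 _); apply/eqP/le_anti; rewrite nrm2_ge0 andbT.
rewrite addrC -scaleN1r -pi_L2ZD -weighted_funZD.
apply: le_trans (weighted_fun_nrm2 _) _.
by rewrite pi_L2ZD gf scaleN1r addNr /nrm2 normr0 expr0n mulr0.
Qed.

Lemma weighted_opZD a f g : weighted_op (a *: f + g) = a *: weighted_op f + weighted_op g.
Proof.
rewrite -[f]reprK -[g]reprK -pi_L2ZD !weighted_op_pi weighted_funZD.
exact: pi_L2ZD.
Qed.

Lemma weighted_op_nrm2 f : nrm2 (weighted_op f) <= C * nrm2 f.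
Proof. by rewrite -[f]reprK weighted_op_pi weighted_fun_nrm2. Qed.

End weighted_composition.

Section isometry.
Context (R : realType) (V W : normedModType R[i]).
Variables (dv : V -> V -> R[i]) (dw : W -> W -> R[i]).
Hypothesis dvZDl : forall a f g h, dv (a *: f + g) h = a * dv f h + dv g h.
Hypothesis dvC : forall f g, dv g f = (dv f g)^*.
Hypothesis dv_norm : forall f, dv f f = `|f| ^+ 2.
Hypothesis dwZDl : forall a f g h, dw (a *: f + g) h = a * dw f h + dw g h.
Hypothesis dwC : forall f g, dw g f = (dw f g)^*.
Hypothesis dw_norm : forall f, dw f f = `|f| ^+ 2.

(** Polarization, with the coefficients [1] and [i]. *)
Lemma isometry_dot (J : V -> W) :
  (forall a f g, J (a *: f + g) = a *: J f + J g) ->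
  (forall f, nrm2 (J f) = nrm2 f) -> forall f g, dw (J f) (J g) = dv f g.
Proof.
move=> JZD Jn f g.
have D h : dw (J h) (J h) = dv h h.
  by rewrite -(nrm2E dw_norm) -(nrm2E dv_norm) Jn.
have P a : a * dw (J f) (J g) + a^*%C * dw (J g) (J f) = a * dv f g + a^*%C * dv g f.
  have := D (a *: f + g); rewrite JZD !(dwZDl, dvZDl).
  rewrite !(dotZDr dwZDl dwC) !(dotZDr dvZDl dvC) !D.
  set x := dw _ _; set y := dw _ _; set u := dv f g; set v := dv g f => E.
  have := congr1 (fun z => z - a * a^*%C * dv f f - dv g g) E.
  rewrite (_ : _ - _ - _ = a * x + a^*%C * y); last by ring.
  by rewrite (_ : _ - _ - _ = a * u + a^*%C * v); last by ring.
pose i : R[i] := 0 +i* 1; have P1 := P 1; have Pi := P i.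
move: P1 Pi; rewrite rmorph1 !mul1r.
have -> : i^*%C = - i by apply: complex_ext; rewrite //= oppr0.
set x := dw _ _; set y := dw _ _; set u := dv f g; set v := dv g f => E1 Ei.
have : x - y = u - v.
  have i0 : i != 0 by rewrite eq_complex/= oner_eq0 andbF.
  apply: (mulfI i0); rewrite !mulrBr; by rewrite !mulNr in Ei.
move=> E2.
have : 2 * x = 2 * u.
  have -> : 2 * x = (x + y) + (x - y) by ring.
  by rewrite E1 E2; ring.
by apply: mulfI; rewrite pnatr_eq0.
Qed.

End isometry.

(** * Transport of Lebesgue measure to a given probability *)

Section transport.
Context (R : realType).
Local Notation RT := (measurableTypeR R).
Local Notation lam := (lebesgue01 R).

Lemma probability_ray_right_continuous (mu : probability RT R) (y p : R) :
  (forall z, y < z -> (p%:E <= mu `]-oo, z]%classic)%E) ->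
  (p%:E <= mu `]-oo, y]%classic)%E.
Proof.
move=> h.
pose F n : set RT := `]-oo, (y + n.+1%:R^-1)]%classic.
have FE : \bigcap_n F n = `]-oo, y]%classic.
  apply/seteqP; split => x /=; rewrite ?in_itv/=.
  - move=> xF; apply/ler_addgt0Pr => e e0.
    have [n ne] : exists n : nat, n.+1%:R^-1 < e.
      near \oo%classic => n; exists n; near: n.
      exact: near_infty_natSinv_lt (PosNum e0).
    have := xF n Logic.I; rewrite /F/= in_itv/= => /le_trans; apply.
    by rewrite lerD2l ltW.
  - by move=> xy n _; rewrite /F/= in_itv/= (le_trans xy)// lerDl.
have mF n : measurable (F n) by exact: measurable_itv.
have cF : mu (F n) @[n --> \oo] --> mu `]-oo, y]%classic.
  rewrite -FE; apply: nonincreasing_cvg_mu => //.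
  - by apply: le_lt_trans (probability_le1 mu (mF 0%N)) _; rewrite ltry.
  - by rewrite FE; exact: measurable_itv.
  - move=> m n mn; apply/subsetPset => x; rewrite /F/= !in_itv/= => /le_trans; apply.
    by rewrite lerD2l lef_pV2 ?posrE// ler_nat ltnS.
apply: (cvge_ge _ cF); apply: nearW => n; apply: h.
by rewrite ltrDl.
Unshelve. all: by end_near.
Qed.

(** Rays to the right generate the Borel sets and are stable under intersection. *)
Lemma eq_measure_rays (m1 m2 : {measure set RT -> \bar R}) :
  (m1 setT < +oo)%E ->
  (forall y : R, m1 `]y, +oo[%classic = m2 `]y, +oo[%classic) ->
  forall E, measurable E -> m1 E = m2 E.
Proof.
move=> m1fin h E mE.
apply: (@measure_unique _ R RT (@RGenOInfty.G R) (fun n => `](- n%:R), +oo[%classic)) => //.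
- exact: RGenOInfty.measurableE.
- move=> _ _ [x ->] [y ->]; exists (Num.max x y); apply/seteqP; split => z /=;
    rewrite !in_itv/= !andbT.
  + by move=> [xz yz]; rewrite gt_max xz yz.
  + by rewrite gt_max => /andP.
- by move=> n; exists (- n%:R).
- apply/seteqP; split => // x _.
  have [n xn] : exists n : nat, - x < n%:R.
    by near \oo%classic => n; exists n; near: n; exact: nbhs_infty_gtr.
  by exists n => //=; rewrite in_itv/= andbT ltrNl.
- by move=> _ [y ->]; exact: h.
- move=> n; apply: le_lt_trans m1fin; apply: le_measure; rewrite ?inE//.
Unshelve. all: by end_near.
Qed.

Section within_set.
Variables (A : set RT) (mA : measurable A) (A0 : lam A != 0%E).

Let afin (E : set RT) : measurable E -> lam E \is a fin_num.
Proof.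
move=> mE; rewrite ge0_fin_numE//; apply: le_lt_trans (lebesgue01_lty R).
by apply: le_measure; rewrite ?inE.
Qed.

Definition occupation (t : R) : R := fine (lam (A `&` `]-oo, t]%classic)).

Let mAt (t : R) : measurable (A `&` `]-oo, t]%classic : set RT).
Proof. by apply: measurableI => //; exact: measurable_itv. Qed.

Let occupationE t : (occupation t)%:E = lam (A `&` `]-oo, t]%classic).
Proof. by rewrite fineK// afin. Qed.

Lemma occupation_nd s t : s <= t -> occupation s <= occupation t.
Proof.
move=> st; rewrite -lee_fin !occupationE; apply: le_measure; rewrite ?inE//.
apply: setIS => x /=; rewrite !in_itv/= => /le_trans; exact.
Qed.

Lemma occupation_le s t : s <= t -> occupation t <= occupation s + (t - s).
Proof.
move=> st; rewrite -lee_fin EFinD !occupationE.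
have mst : measurable (`]s, t]%classic : set RT) by exact: measurable_itv.
have -> : (t - s)%:E = lebesgue_measure (`]s, t]%classic : set R).
  rewrite lebesgue_measure_itv/= lte_fin; have [//|ts] := ltP s t.
  by rewrite (@le_anti _ _ s t) ?subrr// st ts.
apply: (@le_trans _ _ (lam ((A `&` `]-oo, s]%classic) `|` `]s, t]%classic))).
  apply: le_measure; rewrite ?inE//; first exact: measurableU.
  move=> x /= [Ax]; rewrite !in_itv/= => xt.
  by have [xs|xs] := leP x s; [left|right].
apply: le_trans (measureU2 _ _ _) _ => //; apply: leeD => //.
by apply: le_measure; rewrite ?inE//; apply: measurableI => //; exact: measurable_itv.
Qed.

Lemma occupation_continuous : continuous occupation.
Proof.
move=> t; apply/cvgrPdist_lt => e e0; near=> s.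
apply: (@le_lt_trans _ _ `|t - s|); last first.
  by near: s; apply: cvgr_dist_lt => //.
have [st|ts] := leP s t.
- rewrite !ger0_norm ?subr_ge0 ?occupation_nd// lerBlDl.
  exact: occupation_le.
- rewrite distrC [leRHS]distrC !ger0_norm ?subr_ge0 ?occupation_nd ?(ltW ts)// lerBlDl.
  exact: occupation_le (ltW ts).
Unshelve. all: by end_near.
Qed.

Let a := fine (lam A).

Let aE : a%:E = lam A. Proof. by rewrite fineK// afin. Qed.

Let a0 : 0 < a.
Proof. by rewrite lt_neqAle eq_sym fine_ge0// andbT -eqe aE. Qed.

Lemma occupationN1 : occupation (-1) = 0.
Proof.
rewrite /occupation /lebesgue01 /= /mrestr (_ : _ `&` _ = set0) ?measure0//.
apply/seteqP; split => x //= [[_]]; rewrite !in_itv/= => x1 /andP[x0 _].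
by move: (le_trans x0 x1); rewrite oppr_ge0 ler10.
Qed.

Lemma occupation1 : occupation 1 = a.
Proof.
rewrite /occupation /a /lebesgue01 /= /mrestr; congr (fine (lebesgue_measure _)).
apply/seteqP; split => x /=; rewrite !in_itv/=; first by case=> [[]].
by case=> Ax /andP[x0 x1]; rewrite x0 x1 (ltW x1).
Qed.

Lemma occupation_le_a t : occupation t <= a.
Proof. by rewrite -lee_fin occupationE aE; apply: le_measure; rewrite ?inE. Qed.

Lemma occupation_IVT y : 0 <= y <= a -> exists t, occupation t = y.
Proof.
move=> /andP[y0 y1].
have [| | |t _ <-] := @IVT R occupation (-1) 1 y; last by exists t.
- by rewrite (@le_trans _ _ 0)// oppr_le0.
- by apply: continuous_subspaceT => x; exact: occupation_continuous.
- rewrite occupationN1 occupation1.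
  by rewrite (min_l (ltW a0)) (max_r (ltW a0)) y0 y1.
Qed.

Lemma measurable_occupation_le y : measurable ([set x | occupation x <= y] : set RT).
Proof.
have := continuous_measurable_fun occupation_continuous.
move=> /(_ measurableT `]-oo, y]%classic); rewrite setTI.
rewrite (_ : _ @^-1` _ = [set x | occupation x <= y]); first by apply; exact: measurable_itv.
by apply/seteqP; split => x /=; rewrite in_itv.
Qed.

(** Probability integral transform: [occupation] is continuous, so under
    Lebesgue measure on [A] it is uniformly distributed between [0] and [a]. *)
Lemma lam_occupation_le y : 0 <= y <= a ->
  lam (A `&` [set x | occupation x <= y]) = y%:E.
Proof.
move=> y01; have [y0 y1] := andP y01.
have mO := measurable_occupation_le.
apply/eqP; rewrite eq_le; apply/andP; split.
- have [ya|ya] := leP a y.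
    apply: (@le_trans _ _ (lam A)); last by rewrite -aE lee_fin.
    by apply: le_measure; rewrite ?inE//; exact: measurableI.
  apply/lee_addgt0Pr => e e0; rewrite -EFinD.
  (* The perturbed level y + e' must still be a value of the occupation
     function, hence at most a. *)
  pose e' := Num.min e (a - y).
  have e'0 : 0 < e' by rewrite lt_min e0 subr_gt0.
  have [t ty] : exists t, occupation t = y + e'.
    apply: occupation_IVT; rewrite addr_ge0 ?(ltW e'0)//=.
    by rewrite -lerBrDl ge_min lexx orbT.
  apply: (@le_trans _ _ (y + e')%:E); last by rewrite lee_fin lerD2l ge_min lexx.
  rewrite -ty occupationE; apply: le_measure; rewrite ?inE//; first exact: measurableI.
  apply: setIS => x /= xy; rewrite in_itv/= leNgt; apply/negP => /ltW /occupation_nd.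
  by rewrite ty => /(le_trans) /(_ xy); rewrite gerDl leNgt e'0.
- have [t ty] := occupation_IVT y01.
  rewrite -ty occupationE ty; apply: le_measure; rewrite ?inE//; first exact: measurableI.
  by apply: setIS => x /=; rewrite in_itv/= -ty => /occupation_nd.
Qed.

(** The map [phi] is the normalized [occupation] followed by the quantile function
    of [mu]. The first is uniformly distributed under normalized Lebesgue
    measure on [A] and the second turns the uniform law into [mu]. An atom of
    [mu] becomes a part of [A] on which [phi] is constant. *)
Lemma transport_ex (mu : probability RT R) : mu `[0%R, 1%R[%classic = 1%E ->
  exists2 phi : RT -> RT, measurable_fun setT phi &
    forall E, measurable E -> lam (A `&` phi @^-1` E) = (a%:E * mu E)%E.
Proof.
move=> mu01.
have mray (y : R) : measurable (`]-oo, y]%classic : set RT) by exact: measurable_itv.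
pose F y := fine (mu `]-oo, y]%classic).
have FE y : (F y)%:E = mu `]-oo, y]%classic.
  by rewrite fineK// fin_num_measure.
have F1 y : F y <= 1 by rewrite -lee_fin FE probability_le1.
have F0 y : 0 <= F y by rewrite -lee_fin FE.
have F_eq1 y : 1 <= y -> F y = 1.
  move=> y1; apply/eqP; rewrite eq_le F1/= -lee_fin FE -[leLHS]mu01.
  apply: le_measure; rewrite ?inE//.
  by move=> x /=; rewrite !in_itv/= => /andP[_ x1]; rewrite (le_trans (ltW x1)).
have F_eq0 y : y < 0 -> F y = 0.
  move=> y0; apply: EFin_inj; rewrite FE; apply/eqP.
  rewrite eq_le measure_ge0 andbT.
  apply: (@le_trans _ _ (mu (~` [set` `[0 : R, 1 : R[]))); last by rewrite probability_itv01C.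
  apply: le_measure; rewrite ?inE//; try by apply: measurableC; exact: measurable_itv.
  move=> x /=; rewrite !in_itv/= => xy; apply/negP; rewrite negb_and -ltNge.
  by rewrite (le_lt_trans xy y0).
pose G x := occupation x / a.
have G1 x : G x <= 1 by rewrite ler_pdivrMr// mul1r occupation_le_a.
(* The quantile at the level G x is the infimum of S x; restricting to [0, 1]
   keeps S x nonempty and bounded below for every level, 0 and 1 included. *)
pose S x := [set y | 0 <= y <= 1 /\ G x <= F y].
have S1 x : S x 1 by split; [rewrite ler01 lexx|rewrite F_eq1].
have Slb x : has_lbound (S x) by exists 0 => y [/andP[]].
have Sinf x : has_inf (S x) by split => //; exists 1; exact: S1.
pose phi x := inf (S x).
have phi0 x : 0 <= phi x by apply: lb_le_inf; [exists 1; exact: S1|move=> y [/andP[]]].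
have phi1 x : phi x <= 1 by apply: ge_inf.
have phiP x y : 0 <= y <= 1 -> (phi x <= y) = (G x <= F y).
  move=> y01; apply/idP/idP => [xy|GF]; last by apply: ge_inf.
  rewrite -lee_fin FE; apply: probability_ray_right_continuous => z yz.
  have zy : 0 < z - y by rewrite subr_gt0.
  have [u [u01 uG] uz] := inf_adherent zy (Sinf x).
  apply: (@le_trans _ _ (F u)%:E); first by rewrite lee_fin.
  rewrite FE; apply: le_measure; rewrite ?inE// => v /=; rewrite !in_itv/= => vu.
  by rewrite (le_trans vu)// ltW// (lt_le_trans uz)// -lerBrDr opprB addrC subrK.
have mphi : measurable_fun (setT : set RT) (phi : RT -> RT).
  apply: nondecreasing_measurable => // s t st; apply: lb_le_inf; first by exists 1; exact: S1.
  move=> y [y01 yG]; apply: ge_inf => //; split => //; apply: le_trans yG.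
  by rewrite ler_pM2r ?invr_gt0// occupation_nd.
exists phi => //.
have [m1 m1E' _] := pushforward_measure_ex (mrestr lam mA) mphi.
pose m2 : {measure set RT -> \bar R} := mscale (NngNum (ltW a0)) mu.
have m1E E : m1 E = lam (A `&` phi @^-1` E) by rewrite m1E' -[LHS]/(lam (_ `&` A)) setIC.
have m2E E : m2 E = (a%:E * mu E)%E by [].
have mpre (E : set RT) : measurable E -> measurable (phi @^-1` E : set RT).
  by move=> mE; rewrite -[X in measurable X]setTI; exact: mphi.
have m1T : m1 setT = a%:E by rewrite m1E preimage_setT setIT aE.
have m2T : m2 setT = a%:E by rewrite m2E probability_setT mule1.
have key (y : R) : m1 `]-oo, y]%classic = m2 `]-oo, y]%classic.
  rewrite m1E m2E -FE.
  have [y0|y0] := ltP y 0.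
    rewrite F_eq0// mule0 (_ : _ `&` _ = set0) ?measure0//.
    apply/seteqP; split => x //= [_]; rewrite in_itv/= => xy.
    by move: (le_lt_trans (phi0 x) (le_lt_trans xy y0)); rewrite ltxx.
  have [y1|y1] := ltP 1 y.
    rewrite F_eq1 ?ltW// mule1 aE; congr (lam _).
    apply/seteqP; split => x /=; first by case.
    by move=> Ax; split => //; rewrite in_itv/= (le_trans (phi1 x))// ltW.
  rewrite -EFinM -lam_occupation_le; last first.
    by rewrite mulr_ge0 ?F0 ?(ltW a0)//= ger_pMr// F1.
  congr (lam (_ `&` _)); apply/seteqP; split => x /=; rewrite in_itv/= phiP ?y0//;
    by rewrite /G ler_pdivrMr// mulrC.
have cE (m : {measure set RT -> \bar R}) (y : R) : m setT = a%:E ->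
    m `]y, +oo[%classic = (a%:E - m `]-oo, y]%classic)%E.
  move=> mT; have mfin : (m setT < +oo)%E by rewrite mT ltry.
  rewrite -setCitvl -setTD measureD ?setTI//.
  by congr (_ - _)%E; exact: mT.
have m12 : forall E, measurable E -> m1 E = m2 E.
  apply: (@eq_measure_rays m1 m2); first by rewrite m1T ltry.
  by move=> z; rewrite !cE// key.
by move=> E mE; rewrite -m1E m12.
Qed.

End within_set.
End transport.

(** * Adjoint of a weighted composition isometry *)

Section density_measure.
Context d (T : measurableType d) (R : realType) (m : {measure set T -> \bar R}).
Hypothesis mfin : (m setT < +oo)%E.

(** The measure [A |-> \int[m]_(x in A) f x] integrates [h] to the integral of
    [h * f]: it has some density with this property by [density_ex], and
    densities are unique up to null sets. *)
Lemma density_measure_ex (f : T -> R) : (forall x, 0 <= f x) ->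
  m.-integrable setT (EFin \o f) ->
  exists nu : {measure set T -> \bar R}, (nu setT < +oo)%E /\
    forall h : T -> \bar R, (forall x, (0 <= h x)%E) -> measurable_fun setT h ->
      (\int[nu]_x h x = \int[m]_x (h x * (f x)%:E))%E.
Proof.
move=> f0 fi.
have nu0 E : (0 <= induced_charge fi E)%E.
  by apply: integral_ge0 => x _; rewrite lee_fin.
pose nu : {measure set T -> \bar R} := measure_of_charge _ nu0.
have nuE E : nu E = (\int[m]_(x in E) (f x)%:E)%E by [].
have nufin : (nu setT < +oo)%E.
  rewrite nuE; have /integrableP[_] := fi.
  by under eq_integral => x _ do rewrite /= ger0_norm//.
have mf := measurable_int _ fi.
have num : nu `<< m.
  apply/null_content_dominatesP => A mA A0; rewrite [LHS]nuE.
  by apply: null_set_integral => //; exact: measurable_funTS.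
exists nu; split => // h h0 mh.
have [g [mg g0 gE]] := density_ex mfin nufin num.
rewrite gE//; apply: ae_eq_integral => //.
- by apply: emeasurable_funM => //; exact/measurable_EFinP.
- exact: emeasurable_funM.
have fg : ae_eq m setT (EFin \o f) (EFin \o g).
  apply: integral_ae_eq => //; first exact/measurable_EFinP.
  move=> E _ mE; rewrite -nuE -[LHS]mul1e -integral_cst// integral_mkcond gE.
  - rewrite [RHS]integral_mkcond; apply: eq_integral => x _.
    by rewrite /patch; case: ifP; rewrite ?mul1e ?mul0e.
  - by move=> x; rewrite /patch; case: ifP.
  - by apply/(measurable_restrictT _ _).1.
by apply: filterS fg => x fgx xT /=; congr (_ * _)%E; exact: (esym (fgx xT)).
Qed.

End density_measure.

Section adjoint.
Context d1 d2 (T1 : measurableType d1) (T2 : measurableType d2) (R : realType).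
Variables (m1 : {measure set T1 -> \bar R}) (m2 : {measure set T2 -> \bar R}).
Hypotheses (m1fin : (m1 setT < +oo)%E) (m2fin : (m2 setT < +oo)%E).
Variables (phi : T2 -> T1) (w : T2 -> R).
Hypotheses (mphi : measurable_fun setT phi) (mw : measurable_fun setT w).
Hypothesis w0 : forall x, 0 <= w x.
Hypothesis wE : forall h : T1 -> \bar R, (forall x, (0 <= h x)%E) ->
  measurable_fun setT h ->
  (\int[m2]_x ((w x ^+ 2)%:E * h (phi x)) = \int[m1]_x h x)%E.

Lemma weighted_le (h : T1 -> \bar R) : (forall x, (0 <= h x)%E) ->
  measurable_fun setT h ->
  (\int[m2]_x ((w x ^+ 2)%:E * h (phi x)) <= 1%:E * \int[m1]_x h x)%E.
Proof. by move=> h0 mh; rewrite wE// mul1e. Qed.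

Definition transfer : L2 m1 -> L2 m2 := weighted_op mphi mw weighted_le.

Lemma transferZD a f g : transfer (a *: f + g) = a *: transfer f + transfer g.
Proof. exact: weighted_opZD. Qed.

Lemma transfer_pi f : transfer (\pi_(L2 m1) f) = \pi_(L2 m2) (weighted_fun mphi mw weighted_le f).
Proof. exact: weighted_op_pi. Qed.

Lemma transfer_nrm2 f : nrm2 (transfer f) = nrm2 f.
Proof.
rewrite -[f]reprK transfer_pi; apply: EFin_inj; rewrite !L2nrm2E -wE.
- by apply: eq_integral => x _; rewrite normcM normc_real exprMn real_normK ?num_real.
- by move=> x; rewrite lee_fin sqr_ge0.
- by apply/measurable_EFinP; apply: measurable_funX; exact: L2fun_measurable_normc.
Qed.

Lemma transfer_dot f g : L2dot (transfer f) (transfer g) = L2dot f g.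
Proof.
apply: (isometry_dot (dv := @L2dot _ _ _ m1) (dw := @L2dot _ _ _ m2)).
- exact: L2dotZDl.
- exact: L2dotC.
- exact: L2dot_norm.
- exact: L2dotZDl.
- exact: L2dotC.
- exact: L2dot_norm.
- exact: transferZD.
- exact: transfer_nrm2.
Qed.

Lemma cintegral_real d (T : measurableType d) (m : {measure set T -> \bar R})
    (F : T -> R[i]) (r : T -> R) : (forall x, F x = (r x)%:C) ->
  cintegral m F = (fine (\int[m]_x (r x)%:E))%:C.
Proof.
move=> FE; apply: complex_ext => /=.
  by rewrite /Rintegral; congr fine; apply: eq_integral => x _; rewrite FE.
by rewrite /Rintegral integral0_eq// => x _; rewrite FE.
Qed.

Section nonnegative_symbol.
Variable k : T2 -> R.
Hypotheses (k0 : forall x, 0 <= k x) (mk : measurable_fun setT k).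
Hypothesis k2 : (\int[m2]_x (k x ^+ 2)%:E < +oo)%E.

(** The adjoint of [transfer] sends [k] to the density of the image under [phi]
    of the measure with density [w * k]. This image is absolutely continuous:
    if [E] is [m1]-null then by [wE] the weight [w] vanishes almost
    everywhere on the preimage of [E]. *)
Lemma nonneg_adjoint_ex : exists rho : T1 -> R, [/\ measurable_fun setT rho,
  forall x, 0 <= rho x &
  forall h : T1 -> \bar R, (forall x, (0 <= h x)%E) -> measurable_fun setT h ->
    (\int[m1]_x (h x * (rho x)%:E) = \int[m2]_x (h (phi x) * (w x * k x)%:E))%E].
Proof.
have w2 : (\int[m2]_x (w x ^+ 2)%:E < +oo)%E.
  have m1c : measurable_fun (setT : set T1) (fun=> 1%E : \bar R) by exact: measurable_cst.
  have := wE (fun=> lee01) m1c.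
  under eq_integral do rewrite mule1.
  by move=> ->; rewrite integral_cst// mul1e.
have wk0 x : 0 <= w x * k x by rewrite mulr_ge0.
have [nu2 [nu2fin nu2E]] := density_measure_ex m2fin wk0 (integrable_mul2 mw mk w2 k2).
have [nu nuP nuE] := pushforward_measure_ex nu2 mphi.
have nufin : (nu setT < +oo)%E by rewrite nuP preimage_setT.
have num : nu `<< m1.
  apply/null_content_dominatesP => E mE E0.
  have mind : measurable_fun setT (fun x => (\1_E x)%:E : \bar R).
    by apply/measurable_EFinP; exact: measurable_indic.
  have ind0 x : (0 <= (\1_E x)%:E :> \bar R)%E by rewrite lee_fin.
  have mindphi : measurable_fun setT (fun x => (\1_E (phi x))%:E : \bar R).
    exact: (measurableT_comp mind mphi).
  have mw2 : measurable_fun setT (fun x => ((w x ^+ 2)%:E * (\1_E (phi x))%:E)%E).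
    by apply: emeasurable_funM => //; apply/measurable_EFinP; exact: measurable_funX.
  have : (\int[m2]_x ((w x ^+ 2)%:E * (\1_E (phi x))%:E) = 0)%E.
    by rewrite (wE ind0 mind) integral_indic// setIT; exact: E0.
  have abs0 x : `|((w x ^+ 2)%:E * (\1_E (phi x))%:E)|%E = ((w x ^+ 2)%:E * (\1_E (phi x))%:E)%E.
    by rewrite gee0_abs// mule_ge0 ?lee_fin ?sqr_ge0.
  under eq_integral do rewrite -abs0.
  move=> /(ae_eq_integral_abs _ measurableT mw2) ae0.
  have -> : nu E = (\int[nu]_x (\1_E x)%:E)%E by rewrite integral_indic// setIT.
  rewrite nuE// nu2E// -[RHS](integral0 m2 setT); apply: ae_eq_integral => //.
    by apply: emeasurable_funM => //; apply/measurable_EFinP; exact: measurable_funM.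
  apply: filterS ae0 => x /(_ Logic.I) /eqP; rewrite mule_eq0 => h _.
  have [->|i0] := eqVneq (\1_E (phi x) : R) 0; first by rewrite mul0e.
  move: h; rewrite [X in _ || X](_ : _ = false) ?orbF; last by apply/negbTE; rewrite eqe.
  by rewrite eqe sqrf_eq0 => /eqP ->; rewrite mul0r mule0.
have [rho [mrho rho0 rhoE]] := density_ex m1fin nufin num.
exists rho; split => // h h0 mh.
by rewrite -rhoE// nuE// nu2E//; exact: measurableT_comp.
Qed.

(** Test [rho] against its truncations [t n]. The squared norm of [t n] is at
    most the pairing of [t n] with [rho], that is of the transfer of [t n]
    with [k], hence at most half the sum of the squared norms of [t n] and
    [k]. So the squared norm of [t n], which is finite, is at most that of [k];
    monotone convergence concludes. *)
Lemma nonneg_adjoint_sqr (rho : T1 -> R) : measurable_fun setT rho ->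
  (forall x, 0 <= rho x) ->
  (forall h : T1 -> \bar R, (forall x, (0 <= h x)%E) -> measurable_fun setT h ->
    (\int[m1]_x (h x * (rho x)%:E) = \int[m2]_x (h (phi x) * (w x * k x)%:E))%E) ->
  (\int[m1]_x (rho x ^+ 2)%:E < +oo)%E.
Proof.
move=> mrho rho0 rhoE.
pose t n x := Num.min (rho x) n%:R.
have t0 n x : 0 <= t n x by rewrite le_min rho0 ler0n.
have mt n : measurable_fun setT (t n).
  by apply: measurable_minr => //; exact: measurable_cst.
have mt2 n : measurable_fun setT (fun x => (t n x ^+ 2)%:E).
  by apply/measurable_EFinP; exact: measurable_funX.
have bound n : (\int[m1]_x (t n x ^+ 2)%:E <= \int[m2]_x (k x ^+ 2)%:E)%E.
  have tfin : (\int[m1]_x (t n x ^+ 2)%:E < +oo)%E.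
    apply: (@le_lt_trans _ _ (\int[m1]_x (n%:R ^+ 2)%:E)%E).
      apply: ge0_le_integral => //.
      - by move=> x _; rewrite lee_fin sqr_ge0.
      - by move=> x _; rewrite lee_fin ler_sqr ?nnegrE// ge_min lexx orbT.
    by rewrite integral_cst// -ge0_fin_numE ?mule_ge0 ?lee_fin ?sqr_ge0// fin_numM// ge0_fin_numE.
  have step1 : (\int[m1]_x (t n x ^+ 2)%:E <= \int[m1]_x ((t n x)%:E * (rho x)%:E))%E.
    apply: ge0_le_integral => //.
    - by move=> x _; rewrite lee_fin sqr_ge0.
    - by apply: emeasurable_funM; exact/measurable_EFinP.
    - by move=> x _; rewrite -EFinM lee_fin expr2 ler_wpM2l// ge_min lexx.
  have step2 : (\int[m1]_x ((t n x)%:E * (rho x)%:E) <=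
      2^-1%:E * \int[m1]_x (t n x ^+ 2)%:E + 2^-1%:E * \int[m2]_x (k x ^+ 2)%:E)%E.
    rewrite (rhoE (EFin \o t n)); [|by move=> x; rewrite lee_fin|exact/measurable_EFinP].
    rewrite -wE//; last by move=> x; rewrite lee_fin sqr_ge0.
    have mtp : measurable_fun setT (fun x => t n (phi x)) by exact: measurableT_comp.
    have mA : measurable_fun setT (fun x => ((w x ^+ 2)%:E * (t n (phi x) ^+ 2)%:E)%E).
      by apply: emeasurable_funM; apply/measurable_EFinP; exact: measurable_funX.
    have mB : measurable_fun setT (fun x => (k x ^+ 2)%:E).
      by apply/measurable_EFinP; exact: measurable_funX.
    rewrite -!ge0_integralZl//; first last.
    - by move=> x _; rewrite mule_ge0 ?lee_fin ?sqr_ge0.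
    - by move=> x _; rewrite lee_fin sqr_ge0.
    rewrite -ge0_integralD//; first last.
    - exact: measurable_funeM.
    - by move=> x _; rewrite -EFinM lee_fin mulr_ge0 ?sqr_ge0.
    - exact: measurable_funeM.
    - by move=> x _; rewrite -!EFinM lee_fin !mulr_ge0 ?sqr_ge0.
    apply: ge0_le_integral => //.
    - by move=> x _; rewrite -EFinM lee_fin !mulr_ge0.
    - apply: emeasurable_funM; first exact/measurable_EFinP.
      by apply/measurable_EFinP; exact: measurable_funM.
    - by apply: emeasurable_funD; exact: measurable_funeM.
    move=> x _; rewrite -!EFinM -EFinD lee_fin.
    by have := sqr_ge0 (w x * t n (phi x) - k x); nra.
  have := le_trans step1 step2.
  have k20 : (0 <= \int[m2]_x (k x ^+ 2)%:E)%E.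
    by apply: integral_ge0 => x _; rewrite lee_fin sqr_ge0.
  have t20 : (0 <= \int[m1]_x (t n x ^+ 2)%:E)%E.
    by apply: integral_ge0 => x _; rewrite lee_fin sqr_ge0.
  move: tfin t20 k20 k2; case: (integral m1 _ _) => [p| |]//; case: (integral m2 _ _) => [q| |]//.
  by move=> _ _ _ _; rewrite -!EFinM -EFinD !lee_fin; lra.
apply: le_lt_trans k2.
have -> : (\int[m1]_x (rho x ^+ 2)%:E = \int[m1]_x (limn (fun n => (t n x ^+ 2)%:E)))%E.
  apply: eq_integral => x _; apply/esym/cvg_lim => //; apply: cvg_near_cst.
  near=> n; rewrite /t min_l//; near: n; exact: nbhs_infty_ger.
rewrite monotone_convergence//; first last.
- move=> x _ a b ab; rewrite lee_fin ler_sqr ?nnegrE// le_min !ge_min lexx/=.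
  by rewrite ler_nat ab orbT.
- by move=> n x _; rewrite lee_fin sqr_ge0.
apply: lime_le; last by apply: nearW => n; exact: bound.
apply: ereal_nondecreasing_is_cvgn => a b ab; apply: ge0_le_integral => //.
- by move=> x _; rewrite lee_fin sqr_ge0.
- move=> x _; rewrite lee_fin ler_sqr ?nnegrE// le_min !ge_min lexx/=.
  by rewrite ler_nat ab orbT.
Unshelve. all: by end_near.
Qed.

End nonnegative_symbol.

(** Both sides are linear in [f] and conjugate linear in [u], so it is enough to
    treat nonnegative functions. *)
Lemma adjoint_ex (u : L2 m2) : exists v : L2 m1,
  forall f, L2dot f v = L2dot (transfer f) u.
Proof.
move: u; apply: L2_nonneg_ind => [a u u' [v vE] [v' vE']|u uIm uRe].
  exists (a *: v + v') => f.
  rewrite (dotZDr (@L2dotZDl _ _ _ m1) (@L2dotC _ _ _ m1)).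
  by rewrite (dotZDr (@L2dotZDl _ _ _ m2) (@L2dotC _ _ _ m2)) vE vE'.
have mu := L2fun_measurable_Re u.
have [rho [mrho rho0 rhoE]] := nonneg_adjoint_ex uRe mu (L2fun_Re_lty u).
have rho2 := nonneg_adjoint_sqr uRe mu (L2fun_Re_lty u) mrho rho0 rhoE.
have rhoL : (fun x => (rho x)%:C) \in sqintegrable m1.
  apply: square_integrableP => //; first exact: measurable_cst.
  by under eq_integral do rewrite normc_real real_normK ?num_real//.
pose v := MkL2fun rhoL.
exists (\pi_(L2 m1) v); apply: L2_nonneg_ind => [a f g fE gE|f fIm fRe].
  by rewrite transferZD !L2dotZDl fE gE.
have fE x : f x = (complex.Re (f x))%:C by apply: complex_ext => //=.
have uE x : u x = (complex.Re (u x))%:C by apply: complex_ext => //=.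
rewrite transfer_pi !L2dot_pi.
rewrite (@cintegral_real _ _ _ _ (fun x => complex.Re (f x) * rho x)); last first.
  by move=> x; apply: complex_ext; rewrite ?(cReM, cImM)/= fIm; ring.
rewrite (@cintegral_real _ _ _ _
    (fun x => complex.Re (f (phi x)) * (w x * complex.Re (u x)))); last first.
  move=> x; rewrite -[weighted_fun _ _ _ _ _]/((w x)%:C * f (phi x)) (fE (phi x)) (uE x).
  by apply: complex_ext; rewrite ?(cReM, cImM)/=; ring.
congr ((fine _)%:C).
have h0 x : (0 <= (complex.Re (f x))%:E)%E by rewrite lee_fin.
have mh : measurable_fun setT (fun x => (complex.Re (f x))%:E).
  by apply/measurable_EFinP; exact: L2fun_measurable_Re.
have := rhoE _ h0 mh.
by under eq_integral do rewrite -EFinM; under [in X in _ = X -> _]eq_integral do rewrite -EFinM.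
Qed.

End adjoint.

(** * Measures that are not singular *)

Section nonsingular_case.
Context (R : realType).
Local Notation RT := (measurableTypeR R).
Local Notation lam := (lebesgue01 R).
Local Notation el := (expi_class (lebesgue01_lty R)).

Lemma restricted_le (m m' : {measure set RT -> \bar R}) (A : set RT) (k : R) :
  measurable A -> 0 < k ->
  (forall E, measurable E -> E `<=` A -> (m E <= k%:E * m' E)%E) ->
  forall h : RT -> \bar R, (forall x, (0 <= h x)%E) -> measurable_fun setT h ->
  (\int[m]_x (((\1_A x : R) ^+ 2)%:E * h x) <= k%:E * \int[m']_x h x)%E.
Proof.
move=> mA k0 mm' h h0 mh.
have -> : (\int[m]_x (((\1_A x : R) ^+ 2)%:E * h x) = \int[mrestr m mA]_x h x)%E.
  rewrite ge0_integral_mrestr//; apply: eq_integral => x _.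
  by rewrite indicE; case: (x \in A); rewrite ?expr1n ?expr0n.
pose m2 : {measure set RT -> \bar R} := mscale (NngNum (ltW k0)) m'.
have -> : (k%:E * \int[m']_x h x = \int[m2]_x h x)%E by rewrite ge0_integral_mscale.
apply: ge0_le_measure_integral => // E mE.
rewrite -[leLHS]/(m (E `&` A)) -[leRHS]/(k%:E * m' E)%E.
have mEA : measurable (E `&` A) by exact: measurableI.
apply: le_trans (mm' _ mEA _) _; first by move=> x [].
by apply: lee_wpmul2l; [rewrite lee_fin ltW|apply: le_measure; rewrite ?inE// => x []].
Qed.

Section construction.
Variables (mu : probability RT R) (mu01 : mu `[0%R, 1%R[%classic = 1%E).
Variables (A : set RT) (k : R).
Hypotheses (mA : measurable A) (k0 : 0 < k) (A0 : lam A != 0%E).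
Hypothesis muA : forall E, measurable E -> E `<=` A -> (mu E <= k%:E * lam E)%E.
Hypothesis lamA : forall E, measurable E -> E `<=` A -> (lam E <= k%:E * mu E)%E.

Let mind : measurable_fun (setT : set RT) (\1_A : RT -> R).
Proof. exact: measurable_indic. Qed.

Let mid : measurable_fun (setT : set RT) (id : RT -> RT).
Proof. exact: measurable_id. Qed.

Definition restriction : L2 mu -> L2 lam :=
  weighted_op mid mind (restricted_le mA k0 lamA).

Definition extension : L2 lam -> L2 mu :=
  weighted_op mid mind (restricted_le mA k0 muA).

(** [J f] is [c * \1_A * (f \o phi)] with [phi] from [transport_ex] and [c ^+ 2]
    the inverse of the Lebesgue measure of [A]. It is isometric since [phi]
    transports the normalized Lebesgue measure of [A] to [mu]. The other
    properties hold since [J f] vanishes off [A]. *)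
Lemma embedding_ex : exists J : L2 mu -> L2 lam,
  [/\ forall f g, L2dot (J f) (J g) = L2dot f g,
      forall f, restriction (extension (J f)) = J f,
      forall f n, L2dot (J f) (restriction (expi_L2 mu n)) = L2dot (J f) (el n) &
      forall u, exists v, forall f, L2dot f v = L2dot (J f) u].
Proof.
have [phi mphi phiE] := transport_ex mA A0 mu01.
set a := fine (lam A) in phiE.
have a0 : 0 < a.
  rewrite lt_neqAle eq_sym fine_ge0// andbT -eqe fineK//.
  rewrite ge0_fin_numE//; apply: le_lt_trans (lebesgue01_lty R).
  by apply: le_measure; rewrite ?inE.
pose w x : R := Num.sqrt a^-1 * \1_A x.
have mw : measurable_fun (setT : set RT) w by exact: measurable_funM.
have w0 x : 0 <= w x by rewrite mulr_ge0 ?sqrtr_ge0.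
have w2 x : w x ^+ 2 = a^-1 * \1_A x.
  rewrite exprMn sqr_sqrtr ?invr_ge0 ?ltW//; congr (_ * _).
  by rewrite indicE; case: (x \in A); rewrite ?expr1n ?expr0n.
have w1 x : w x * \1_A x = w x.
  by rewrite /w -mulrA -expr2 indicE; case: (x \in A); rewrite ?expr1n ?expr0n.
have wE (h : RT -> \bar R) : (forall x, (0 <= h x)%E) -> measurable_fun setT h ->
    (\int[lam]_x ((w x ^+ 2)%:E * h (phi x)) = \int[mu]_x h x)%E.
  move=> h0 mh.
  have mhphi : measurable_fun (setT : set RT) (h \o phi) by exact: measurableT_comp.
  have [m' m'E m'I] := pushforward_measure_ex (mrestr lam mA) mphi.
  under eq_integral do rewrite w2 EFinM -muleA.
  rewrite ge0_integralZl//; first last.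
  - by rewrite lee_fin invr_ge0 ltW.
  - by move=> x _; rewrite mule_ge0// lee_fin.
  - by apply: emeasurable_funM => //; exact/measurable_EFinP.
  rewrite -(ge0_integral_mrestr lam mA (f := fun x => h (phi x)))// -m'I//.
  pose m2 : {measure set RT -> \bar R} := mscale (NngNum (ltW a0)) mu.
  rewrite (@eq_measure_integral _ _ _ setT m2 m'); last first.
    move=> E mE _; rewrite -[RHS]/(a%:E * mu E)%E -phiE// m'E.
    by rewrite -[LHS]/(lam (_ `&` A)) setIC.
  by rewrite ge0_integral_mscale// muleA -EFinM mulVf ?mul1e ?gt_eqF.
exists (transfer mphi mw wE); split.
- exact: transfer_dot.
- move=> f; rewrite -[f]reprK transfer_pi /restriction /extension !weighted_op_pi.
  congr (\pi_(L2 lam) _); apply: val_inj; apply/funext => x.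
  set F := repr f.
  rewrite -[LHS]/((\1_A x)%:C * ((\1_A x)%:C * ((w x)%:C * F (phi x)))).
  rewrite -[RHS]/((w x)%:C * F (phi x)) /w indicE.
  by case: (x \in A); rewrite ?mulr1n ?mulr0n ?mulr1 ?mulr0 ?rmorph1 ?rmorph0 ?mul1r ?mul0r.
- move=> f n; rewrite -[f]reprK transfer_pi /restriction expi_L2E weighted_op_pi !L2dot_pi.
  congr (cintegral lam _); apply/funext => x; set F := repr f.
  rewrite -[LHS]/(((w x)%:C * F (phi x)) * ((\1_A x)%:C * expi n x)^*).
  rewrite -[RHS]/(((w x)%:C * F (phi x)) * (expi n x)^*).
  rewrite /w indicE; case: (x \in A); last by rewrite mulr0n mulr0 rmorph0 !mul0r.
  by rewrite mulr1n rmorph1 mul1r.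
- by move=> u; apply: adjoint_ex => //; [exact: probability_lty|exact: lebesgue01_lty].
Qed.

(** Let [S] be the adjoint of [J] and [B = S \o restriction]. Then [S \o J] is the
    identity because [J] is isometric, and every [J g] is the restriction of
    its own extension by zero, so [B] is onto. The inner product of [f] with
    [B e_n] equals that of [J f] with the exponential [e_n] in L2([0, 1)), so
    the Parseval identity for [B e_n] is that of Fourier series. *)
Lemma SCFC_of_comparable : SCFC (@L2dot _ _ _ mu) (expi_L2 mu).
Proof.
have [J [JJ JE Je Jadj]] := embedding_ex.
have /choice[S SE] := Jadj.
pose B f := S (restriction f).
have BL : linear B.
  move=> c f g; apply: (dot_nondegenerate (dot := @L2dot _ _ _ mu)).
  - exact: L2dotZDl.
  - exact: L2dotC.
  - exact: L2dot_norm.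
  move=> h; rewrite (dotZDr (@L2dotZDl _ _ _ mu) (@L2dotC _ _ _ mu)) !SE.
  rewrite /restriction weighted_opZD.
  by rewrite (dotZDr (@L2dotZDl _ _ _ lam) (@L2dotC _ _ _ lam)).
have Jn f : nrm2 (J f) = nrm2 f.
  apply: complexI; rewrite (nrm2E (@L2dot_norm _ _ _ lam)) JJ.
  by rewrite (nrm2E (@L2dot_norm _ _ _ mu)).
have Sn z : nrm2 (S z) <= nrm2 z.
  (* S contracts norms: J (S z) is the orthogonal projection of z on the range
     of J. *)
  have : (nrm2 (J (S z) - z))%:C = (nrm2 z - nrm2 (S z))%:C.
    rewrite rmorphB/= !(nrm2E (@L2dot_norm _ _ _ lam), nrm2E (@L2dot_norm _ _ _ mu)).
    rewrite (dotBl (@L2dotZDl _ _ _ lam)).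
    rewrite !(dotBr (@L2dotZDl _ _ _ lam) (@L2dotC _ _ _ lam)) JJ -SE.
    rewrite (L2dotC (J (S z)) z) -SE -[L2dot (S z) (S z)](nrm2E (@L2dot_norm _ _ _ mu)).
    by rewrite conjc_real; ring.
  by move/complexI => E; rewrite -subr_ge0 -E nrm2_ge0.
pose BLin : {linear L2 mu -> L2 mu} := HB.pack B (GRing.isLinear.Build _ _ _ _ B BL).
exists BLin; split.
- exists (Num.sqrt k) => f; rewrite -normcr_Re -[`|f|]normcr_Re -rmorphM lecR.
  rewrite -ler_sqr ?nnegrE ?mulr_ge0 ?sqrtr_ge0//; try by rewrite -ler0c normcr_Re.
  rewrite exprMn sqr_sqrtr ?(ltW k0)// -!/(nrm2 _).
  by apply: le_trans (Sn _) _; exact: weighted_op_nrm2.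
- move=> g; exists (extension (J g)).
  apply: (dot_nondegenerate (dot := @L2dot _ _ _ mu)).
  - exact: L2dotZDl.
  - exact: L2dotC.
  - exact: L2dot_norm.
  by move=> f; rewrite SE JE JJ.
- move=> f; rewrite -[RHS]/((nrm2 f)%:E) -Jn -[RHS]fourier_parseval.
  by apply: eq_esum => n _; rewrite SE Je.
Qed.

End construction.
End nonsingular_case.

Theorem theorem7p1 (R : realType) (mu : probability (measurableTypeR R) R)
    (mu01 : mu `[0%R, 1%R[%classic = 1%E) :
  (has_ac_part mu (lebesgue01 R) -> SCFC (@L2dot _ _ _ mu) (expi_L2 mu)) /\
  (mutually_singular mu (lebesgue01 R) ->
   forall B : L2 mu -> L2 mu,
     linear_on (lspan (expi_L2 mu)) B ->
     parseval_frame (@L2dot _ _ _ mu) (fun n => B (expi_L2 mu n)) ->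
     ~ closable (lspan (expi_L2 mu)) B).
Proof.
split=> [/comparable_set_ex[A [k [mA k0 A0 AE]]]|sing B lB pB].
  by apply: (@SCFC_of_comparable _ _ mu01 A k) => // E mE EA; case: (AE E mE EA).
exact: singular_not_closable.
Qed.
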